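(* Let $a\in\mathbb{Z}^d_+$ and let $\nu$ be a non-negative Borel measure on $\Lambda=(0,\infty)^d$ that satisfies $$\int_\Lambda\prod_{k=1}^d\lambda_k^{-1/2}\Big\{\prod_{j=1}^d\Theta(0;ia_j^2/\lambda_j)-1\Big\}\,d\nu(\lambda)<\infty.$$ Let $g:\mathbb{T}^d\to\mathbb{R}$ be a continuous periodic function such that $$\hat g(k)=\int_\Lambda\hat G_\lambda(k)\,d\nu(\lambda)$$ for all $k\in\mathbb{Z}^d$ such that $|k_j|\ge a_j$ for some $j\in\{1,\dots,d\}$. Then for every real trigonometric polynomial $P$ of degree less than $a$ with $P(x)\ge g(x)$ for all $x\in\mathbb{T}^d$, we have $$\int_{\mathbb{T}^d}\{P(x)-g(x)\}\,dx\ \ge\ \int_\Lambda\prod_{k=1}^d\lambda_k^{-1/2}\Big\{\prod_{j=1}^d\Theta(0;ia_j^2/\lambda_j)-1\Big\}\,d\nu(\lambda).$$ Moreover, there exists a real trigonometric polynomial $m_a$ of degree less than $a$ such that $m_a(x)\ge g(x)$ for all $x\in\mathbb{T}^d$, $m_a$ interpolates $g$ on the lattice $\mathbb{Z}^d/a=\{(n_1/a_1,\dots,n_d/a_d):n\in\mathbb{Z}^d\}$, and $$\int_{\mathbb{T}^d}\{m_a(x)-g(x)\}\,dx=\int_\Lambda\prod_{k=1}^d\lambda_k^{-1/2}\Big\{\prod_{j=1}^d\Theta(0;ia_j^2/\lambda_j)-1\Big\}\,d\nu(\lambda).$$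
   Context: Notation: $\mathbb{T}^d=\mathbb{R}^d/\mathbb{Z}^d$; $\mathbb{Z}^d_+$ is the set of $a\in\mathbb{Z}^d$ with $a_j\ge1$ for all $j$. A trigonometric polynomial $P$ has degree less than $a$ if $P(x)=\sum_{-a<n<a}\hat P(n)e^{2\pi i n\cdot x}$, where $-a<n<a$ means $n\in\mathbb{Z}^d$ and $|n_j|<a_j$ for all $j$. For $\lambda\in(0,\infty)^d$, $G_\lambda(x)=\prod_{j=1}^d e^{-\lambda_j\pi x_j^2}$ on $\mathbb{R}^d$, with Fourier transform $\hat G_\lambda(\xi)=\prod_{j=1}^d\lambda_j^{-1/2}e^{-\pi\xi_j^2/\lambda_j}$. For $g$ on $\mathbb{T}^d$, $\hat g(k)=\int_{\mathbb{T}^d}g(x)e^{-2\pi i k\cdot x}\,dx$. Jacobi's theta function is $\Theta(v;\tau)=\sum_{n\in\mathbb{Z}}e^{2\pi i nv}e^{\pi i\tau n^2}$ for $\operatorname{Im}\tau>0$. *)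

(* Defs.v *)
From HB Require Import structures.
From mathcomp Require Import all_boot all_order all_algebra.
From mathcomp Require Import all_classical all_reals all_analysis.
From mathcomp Require Export complex.
Set Implicit Arguments.
Unset Strict Implicit.
Unset Printing Implicit Defensive.
Import Order.TTheory GRing.Theory Num.Theory.
Import numFieldNormedType.Exports.

Local Open Scope classical_set_scope.
Local Open Scope ring_scope.
Local Open Scope complex_scope.

Definition cexp (R : realType) (z : R[i]) : R[i] :=
  (expR (complex.Re z))%:C * (cos (complex.Im z) +i* sin (complex.Im z)).

Definition clim (R : realType) (u : nat -> R[i]) : R[i] :=
  limn (fun N => complex.Re (u N)) +i* limn (fun N => complex.Im (u N)).

(* The two-sided series is the limit of the partial sums over -N <= n <= N. *)
Definition Theta (R : realType) (v tau : R[i]) : R[i] :=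
  clim (fun N => \sum_(k < N.*2.+1)
    let n : int := k%:Z - N%:Z in
    cexp (2 * pi%:C * 'i * n%:~R * v) * cexp (pi%:C * 'i * tau * n%:~R ^+ 2)).

(* Functions on T^d are Z^d-periodic functions on R^d = 'rV[R]_d. *)
Definition Zperiodic (R : realType) (d : nat) (T : Type) (f : 'rV[R]_d -> T) :=
  forall (x : 'rV[R]_d) (n : 'rV[int]_d), f (x + map_mx intr n) = f x.

Section torus_measure.
Variable R : realType.
Let RT := measurableTypeR R.

Definition tuple_cons (n : nat) (p : RT * n.-tuple RT) : n.+1.-tuple RT :=
  [the n.+1.-tuple RT of p.1 :: p.2].

Let measurable_tuple_cons n : measurable_fun setT (@tuple_cons n).
Proof. exact: measurable_cons. Qed.

HB.instance Definition _ n :=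
  isMeasurableFun.Build _ _ _ _ (@tuple_cons n) (@measurable_tuple_cons n).

(* Lebesgue measure on the fundamental domain [0,1]^d of T^d, as the product
   of d copies of Lebesgue measure on [0,1]. *)
Fixpoint torus_measure (d : nat) : probability (d.-tuple RT) R :=
  if d is n.+1 then
    distribution (uniform_prob (@ltr01 R) \x torus_measure n)%E (@tuple_cons n)
  else \d_[tuple].

End torus_measure.

Definition row_of_tuple (R : Type) (d : nat) (t : d.-tuple R) : 'rV[R]_d :=
  \row_j tnth t j.

Definition torus_int (R : realType) (d : nat) (f : 'rV[R]_d -> R) : R :=
  (\int[torus_measure R d]_t f (row_of_tuple t))%R.

Definition torus_cint (R : realType) (d : nat) (f : 'rV[R]_d -> R[i]) : R[i] :=
  torus_int (fun x => complex.Re (f x)) +i* torus_int (fun x => complex.Im (f x)).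

Definition dotZ (R : realType) (d : nat) (n : 'rV[int]_d) (x : 'rV[R]_d) : R :=
  \sum_(j < d) (n 0 j)%:~R * x 0 j.

Definition fourier (R : realType) (d : nat) (g : 'rV[R]_d -> R)
    (k : 'rV[int]_d) : R[i] :=
  torus_cint (fun x => (g x)%:C * cexp (- (2 * pi%:C * 'i * (dotZ k x)%:C))).

Definition box (d : nat) (a : 'I_d -> nat) : set 'rV[int]_d :=
  [set n | forall j, `|n 0 j| < (a j)%:Z].

(* The box is finite, so the finitely supported sum below is the usual one. *)
Definition trigpoly_lt (R : realType) (d : nat) (a : 'I_d -> nat)
    (P : 'rV[R]_d -> R) :=
  forall x, (P x)%:C =
    \sum_(n \in box a) fourier P n * cexp (2 * pi%:C * 'i * (dotZ n x)%:C).

(* A measure on Lambda is represented by a Borel measure on R^d, of which only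
   the restriction to Lambda is ever used. *)
Definition borel (R : realType) (d : nat) :=
  g_sigma_algebraType (@open 'rV[R]_d).

Definition Lambda (R : realType) (d : nat) : set 'rV[R]_d :=
  [set l | forall j, 0 < l 0 j].

(* Closed form of the Fourier transform on R^d of the Gaussian
   x |-> \prod_j exp (- l_j pi x_j ^ 2). *)
Definition Ghat (R : realType) (d : nat) (l xi : 'rV[R]_d) : R :=
  \prod_(j < d) (l 0 j `^ (- 2^-1) * expR (- pi * xi 0 j ^+ 2 / l 0 j)).

(* The expression is real for l in Lambda; Re only changes its type. *)
Definition theta_weight (R : realType) (d : nat) (a : 'I_d -> nat)
    (l : 'rV[R]_d) : R :=
  \prod_(k < d) (l 0 k `^ (- 2^-1)) *
  complex.Re (\prod_(j < d) Theta 0 ('i * ((a j)%:R ^+ 2 / l 0 j)%:C) - 1).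

Definition theta_int (R : realType) (d : nat) (a : 'I_d -> nat)
    (nu : {measure set (borel R d) -> \bar R}) : \bar R :=
  (\int[nu]_(l in (@Lambda R d : set (borel R d))) (theta_weight a l)%:E)%E.

Definition lattice_point (R : realType) (d : nat) (a : 'I_d -> nat)
    (n : 'rV[int]_d) : 'rV[R]_d :=
  \row_j ((n 0 j)%:~R / (a j)%:R).

(* Main.v *)
(* In one variable, [gauss_product_cos], a finite form of the Jacobi triple
   product, approximates a periodised Gaussian by a product of increasing
   affine functions of [cos t] that are nonnegative on [-1, 1]. All divided
   differences of such a product are nonnegative, so the remainder of its
   division by [cheb a - 1], whose roots are the values [cos (2 pi j / a)],
   majorises it and has degree less than [a]; the Gaussian limit inherits this.
   Products over the coordinates then majorise the [d]-dimensional Gaussians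
   with equality on the lattice, and integrating the Fourier coefficients of the
   gap against [nu] gives those of [m_a - g]. The gap is only known through its
   Fourier coefficients: its sign is read off its convolutions with the positive
   kernels [(2 + 2 cos) ^ N], which converge to it pointwise.

   Conversely the mean over the lattice [1/a Z^d] is exact on polynomials of
   degree less than [a], so the integral of [P - g] is at least the lattice mean
   of [g] minus its integral. Applied to the kernel means of [g], this difference
   is a nonnegative sum of integrals of Gaussian coefficients over the nonzero
   frequencies divisible by [a], and Fatou's lemma bounds its limit from below by
   the theta integral. For [P = m_a] both bounds are equalities, and a nonnegative
   gap of lattice mean zero vanishes on the lattice. *)

Require Import Defs.
From mathcomp Require Import all_boot all_order all_algebra.
From mathcomp Require Import all_classical all_reals all_analysis.
From mathcomp Require Import measurable_realfun ring lra zify.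
Import Order.TTheory GRing.Theory Num.Theory.
Import numFieldNormedType.Exports.

Local Open Scope classical_set_scope.
Local Open Scope ring_scope.
Local Open Scope complex_scope.

Set Implicit Arguments.
Unset Strict Implicit.
Unset Printing Implicit Defensive.

(** * Trigonometric identities and sums over roots of unity *)

Section Trigonometry.
Variable R : realType.
Implicit Types x y t : R.

(** Only the gap is sure to be integrable: where all coordinates of [l] are small, [Ghat l 0] may
    have an infinite [nu]-integral, while majorant minus Gaussian has exponentially small mean
    there. Moreover [nu] is an arbitrary measure, so Fubini on [Lambda] times the torus is not at
    hand. Hence the argument lives on Fourier coefficients, and only finite sums, besides the one
    use of Fatou's lemma, are exchanged with the integral against [nu]. This is why the inequality
    in one variable is stated after convolution with an arbitrary nonnegative cosine polynomial. It
    then involves finitely many coefficients and passes to limits term by term; tested on 1 + cos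
    and 1 - cos, it bounds every gap coefficient by the zeroth one, so the single hypothesis on [nu]
    makes all of them integrable. Both halves of 0 <= Gaussian <= majorant are carried along,
    because the product over the coordinates needs nonnegative factors. *)

Definition cis t : R[i] := cos t +i* sin t.

Lemma eqcP (z w : R[i]) : complex.Re z = complex.Re w ->
  complex.Im z = complex.Im w -> z = w.
Proof. by case: z w => [a b] [c d] /= -> ->. Qed.

Lemma Re_sum I (r : seq I) (P : pred I) (F : I -> R[i]) :
  complex.Re (\sum_(i <- r | P i) F i) = \sum_(i <- r | P i) complex.Re (F i).
Proof. exact: (raddf_sum (@complex.Re R : Algebra.Additive.type _ _)). Qed.

Lemma Im_sum I (r : seq I) (P : pred I) (F : I -> R[i]) :
  complex.Im (\sum_(i <- r | P i) F i) = \sum_(i <- r | P i) complex.Im (F i).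
Proof. exact: (raddf_sum (@complex.Im R : Algebra.Additive.type _ _)). Qed.

Lemma ReM (z w : R[i]) : complex.Re (z * w) =
  complex.Re z * complex.Re w - complex.Im z * complex.Im w.
Proof. by case: z w => [a b] [c d]. Qed.

Lemma ImM (z w : R[i]) : complex.Im (z * w) =
  complex.Re z * complex.Im w + complex.Im z * complex.Re w.
Proof. by case: z w => [a b] [c d]. Qed.

Lemma cis0 : cis 0 = 1.
Proof. by rewrite /cis cos0 sin0. Qed.

Lemma cisD x y : cis (x + y) = cis x * cis y.
Proof. by apply: eqcP; rewrite ?ReM ?ImM /= ?cosD ?sinD //; ring. Qed.

Lemma cis_sum I (r : seq I) (P : pred I) (F : I -> R) :
  cis (\sum_(i <- r | P i) F i) = \prod_(i <- r | P i) cis (F i).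
Proof. by rewrite (big_morph cis cisD cis0). Qed.

Lemma cisMn x n : cis (n%:R * x) = cis x ^+ n.
Proof.
elim: n => [|n IH]; first by rewrite mul0r expr0 cis0.
by rewrite exprS -IH -cisD -natr1 mulrDl mul1r addrC.
Qed.

Lemma cisNK x : cis x * cis (- x) = 1.
Proof. by rewrite -cisD subrr cis0. Qed.

Lemma cis_neq0 x : cis x != 0.
Proof.
apply/eqP => h; have := cisNK x; rewrite h mul0r => /eqP.
by rewrite eq_sym oner_eq0.
Qed.

Lemma cisDN x : cis x + cis (- x) = (2 * cos x)%:C.
Proof. by apply: eqcP; rewrite /= ?cosN ?sinN; ring. Qed.

Lemma cos_periodz x (n : int) : cos (x + n%:~R * (2 * pi)) = cos x.
Proof.
have per m y : cos (y + m%:R * (2 * pi)) = cos y.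
  have -> : y + m%:R * (2 * pi) = y + (pi *+ 2) *+ m.
    by rewrite !mulr_natl.
  by rewrite (periodicn (@cosD2pi R)).
case: n => m; first exact: per.
rewrite -[RHS](per m.+1) NegzE mulrNz mulNr.
by rewrite -[in LHS](per m.+1) subrK per.
Qed.

Lemma cis_periodz x (n : int) : cis (x + n%:~R * (2 * pi)) = cis x.
Proof.
have sE y : sin y = - cos (y + pi / 2) by rewrite cosDpihalf opprK.
by apply: eqcP; rewrite /= ?cos_periodz // sE addrAC cos_periodz -sE.
Qed.

Lemma cos_lt1 x : 0 < x < 2 * pi -> cos x < 1.
Proof.
move=> /andP[x0 xpi].
have -> : x = (x / 2) *+ 2 by rewrite -mulr_natl; field.
rewrite cos_mulr2n cos2sin2.
have h : 0 < sin (x / 2) by apply: sin_gt0_pi; apply/andP; split; lra.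
have : 0 < sin (x / 2) ^+ 2 by rewrite exprn_gt0.
by rewrite mulr2n; lra.
Qed.

(** Since 2 sin(al / 2) cos z = sin(z + al / 2) - sin(z - al / 2), consecutive terms cancel. *)
Lemma sum_sin_telescope (y al : R) M :
  2 * sin (al / 2) * (\sum_(s < M) cos (y + s%:R * al)) =
  sin (y + M%:R * al - al / 2) - sin (y - al / 2).
Proof.
elim: M => [|M IH]; first by rewrite big_ord0 mulr0 mul0r addr0 subrr.
rewrite big_ord_recr /= mulrDr IH -[M.+1%:R]natr1.
have -> : y + (M%:R + 1) * al - al / 2 = (y + M%:R * al) + al / 2 by field.
set z := y + M%:R * al.
by rewrite (sinB z) (sinD z); ring.
Qed.

(** Orthogonality of the characters of Z/M. If M does not divide n, then n reduces to some 0 < r <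
    M, the step al = 2 pi r / M has sin(al / 2) > 0, and the two ends of the telescoped sum differ
    by r full periods. The free phase y makes one statement serve real and imaginary parts alike. *)
Lemma sum_cos_roots (y : R) M (n : int) : (0 < M)%N ->
  \sum_(s < M) cos (y + 2 * pi * n%:~R * (s%:R / M%:R)) =
  if (M%:Z %| n)%Z then M%:R * cos y else 0.
Proof.
move=> M0; have M0' : M%:R != 0 :> R by rewrite pnatr_eq0 -lt0n.
case: ifPn => [/dvdzP[m ->]|nd].
  rewrite (eq_bigr (fun=> cos y)); last first.
    move=> s _; rewrite -[RHS](cos_periodz _ (m * s%:Z)); congr (cos (_ + _)).
    by rewrite !intrM /= -!pmulrn; field.
  by rewrite sumr_const card_ord mulr_natl.
pose r := `|(n %% M%:Z)%Z|%N.
have Mz : M%:Z != 0 by rewrite eqz_nat -lt0n.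
have rE : (n %% M%:Z)%Z = r%:Z by rewrite /r gez0_abs // modz_ge0.
have nE : n = (n %/ M%:Z)%Z * M%:Z + r%:Z by rewrite -rE -divz_eq.
have r0 : (0 < r)%N.
  by rewrite lt0n; apply: contra nd => /eqP r0; apply/dvdz_mod0P; rewrite rE r0.
have rM : (r < M)%N by rewrite -ltz_nat -rE ltz_pmod // ltz_nat.
pose al : R := 2 * pi * (r%:R / M%:R).
have pi0 := pi_gt0 R.
have MR : 0 < M%:R :> R by rewrite ltr0n.
have al0 : 0 < al by rewrite /al !mulr_gt0 ?invr_gt0 ?ltr0n.
have al2 : al < 2 * pi.
  by rewrite /al gtr_pMr ?mulr_gt0 // ltr_pdivrMr // mul1r ltr_nat.
have s0 : 0 < sin (al / 2) by apply: sin_gt0_pi; apply/andP; split; lra.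
rewrite (eq_bigr (fun s : 'I_M => cos (y + s%:R * al))); last first.
  move=> s _; rewrite -[RHS](cos_periodz _ ((n %/ M%:Z)%Z * s%:Z)).
  congr cos; rewrite -addrA; congr (_ + _).
  rewrite {1}nE !(intrD, intrM) /= -!pmulrn /al.
  by set q := _%:~R; field.
apply/eqP; rewrite -(mulrI_eq0 _ (mulfI (_ : 2 * sin (al / 2) != 0))); last first.
  by rewrite mulf_neq0 ?gt_eqF.
rewrite sum_sin_telescope.
have -> : y + M%:R * al - al / 2 = (y - al / 2) + (r%:Z)%:~R * (2 * pi).
  by rewrite /al -pmulrn; field.
have sE z : sin z = - cos (z + pi / 2) by rewrite cosDpihalf opprK.
by rewrite !sE addrAC cos_periodz subrr.
Qed.

Lemma prim_root_cis a : (0 < a)%N ->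
  a.-primitive_root (cis (2 * pi / a%:R)).
Proof.
move=> a0; have aR : 0 < a%:R :> R by rewrite ltr0n.
have an0 : a%:R != 0 :> R by rewrite gt_eqF.
rewrite /primitive_root_of_unity a0 /=.
apply/forallP => i; rewrite unity_rootE -cisMn.
apply/eqP; have [->|ne] := eqVneq i.+1 a.
  apply/eqP; rewrite mulrC divfK //.
  by rewrite -[2 * pi]add0r -[X in 0 + X]mul1r (cis_periodz 0 1) cis0.
apply/eqP => /(congr1 (@complex.Re R)) /= h.
have pi0 := pi_gt0 R.
suff hx : (0 : R) < i.+1%:R * (2 * pi / a%:R) < 2 * (pi : R).
  by have := cos_lt1 hx; rewrite h ltxx.
rewrite !mulr_gt0 ?invr_gt0 //= mulrCA gtr_pMr ?mulr_gt0 //.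
by rewrite ltr_pdivrMr // mul1r ltr_nat ltn_neqAle ne ltn_ord.
Qed.

(** With w = e^{ix} and z = e^{2 pi i / a}, each factor times w equals (w - z^j)(w - z^{-j}). The
    product times w^a is therefore (w^a - 1)^2, which is w^a times the right-hand side. *)
Lemma prod_cos_roots a x : (0 < a)%N ->
  \prod_(j < a) (2 * cos x - 2 * cos (2 * pi / a%:R * j%:R)) =
  2 * cos (a%:R * x) - 2.
Proof.
move=> a0; set z := cis (2 * pi / a%:R); set w := cis x.
have zp : a.-primitive_root z by apply: prim_root_cis.
have zN : cis (- (2 * pi / a%:R)) = z^-1.
  by apply: (mulfI (cis_neq0 (2 * pi / a%:R))); rewrite cisNK mulfV ?cis_neq0.
have zp' : a.-primitive_root z^-1.
  rewrite -zN; have -> : cis (- (2 * pi / a%:R)) = conjc z.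
    by rewrite /cis cosN sinN.
  by rewrite (fmorph_primitive_root (@conjc R)).
have P0 u : a.-primitive_root u -> \prod_(j < a) (w - u ^+ j) = w ^+ a - 1.
  move=> /factor_Xn_sub_1/(congr1 (horner^~ w)).
  rewrite big_mkord horner_prod hornerD hornerN hornerXn hornerC => <-.
  by apply: eq_bigr => j _; rewrite hornerXsubC.
have P1 := P0 _ zp; have P2 := P0 _ zp'.
have wa : w ^+ a != 0 by rewrite expf_neq0 ?cis_neq0.
have h : w ^+ a * (\prod_(j < a) (2 * cos x - 2 * cos (2 * pi / a%:R * j%:R)))%:C
   = w ^+ a * (2 * cos (a%:R * x) - 2)%:C.
  rewrite rmorphB /= -(cisDN (a%:R * x)) mulrBr [X in X - _]mulrDr cisMn -/w.
  have e0 : w ^+ a * cis (- (a%:R * x)) = 1 by rewrite -cisMn cisNK.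
  rewrite e0.
  rewrite rmorph_prod /= -{1}(card_ord a) -prodr_const -big_split /=.
  transitivity ((w ^+ a - 1) * (w ^+ a - 1)); last by rewrite /w -cisMn; ring.
  rewrite -{1}P1 -P2 -big_split /=.
  apply: eq_bigr => j _; rewrite rmorphB /= -!cisDN -/w.
  rewrite mulrC (mulrC _ j%:R) -mulrN !cisMn zN -/z.
  have e : z^-1 ^+ j * z ^+ j = 1.
    by rewrite -exprMn mulVf ?cis_neq0 // expr1n.
  have e' : w * cis (- x) = 1 by rewrite cisNK.
  transitivity (w * w + w * cis (- x) - w * z ^+ j - w * z^-1 ^+ j); first by ring.
  by rewrite e' -e; ring.
by have := mulfI wa h => /(congr1 (@complex.Re R)).
Qed.

End Trigonometry.

Section Chebyshev.
Variable R : realType.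
Implicit Types (p F G : {poly R}) (x y t : R).

(** Consecutive Chebyshev polynomials of the first kind T_n, T_{n+1}; the pair makes the three-term
    recurrence structural. *)
Fixpoint cheb2 n : {poly R} * {poly R} :=
  if n is m.+1 then let: (p, q) := cheb2 m in (q, 2%:P * 'X * q - p)
  else (1, 'X).
Definition cheb n := (cheb2 n).1.

Lemma chebSS n : cheb n.+2 = 2%:P * 'X * cheb n.+1 - cheb n.
Proof. by rewrite /cheb /=; case: (cheb2 n). Qed.

Lemma horner_cheb n t : (cheb n).[cos t] = cos (n%:R * t).
Proof.
suff : (cheb n).[cos t] = cos (n%:R * t) /\
       (cheb n.+1).[cos t] = cos (n.+1%:R * t) by case.
elim: n => [|n [IH1 IH2]]; first by rewrite /= hornerC hornerX mul0r cos0 mul1r.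
split=> //; rewrite chebSS hornerD hornerN !hornerM hornerX hornerC IH1 IH2.
have -> : n%:R * t = n.+1%:R * t - t by rewrite -[n.+1%:R]natr1; ring.
have -> : n.+2%:R * t = n.+1%:R * t + t by rewrite -[n.+2%:R]natr1; ring.
by rewrite cosB cosD; ring.
Qed.

Lemma size_cheb n : (size (cheb n) <= n.+1)%N.
Proof.
suff : (size (cheb n) <= n.+1)%N /\ (size (cheb n.+1) <= n.+2)%N by case.
elim: n => [|n [IH1 IH2]]; first by rewrite /cheb /= size_poly1 size_polyX.
split=> //; rewrite chebSS (leq_trans (size_polyD _ _)) // geq_max size_polyN.
rewrite (leq_trans IH1) ?andbT; last by rewrite -addn2 leq_addr.
rewrite -mulrA mul_polyC (leq_trans (size_scale_leq _ _)) //.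
by rewrite (leq_trans (size_polyMleq _ _)) // size_polyX add2n /= ltnS.
Qed.

(** Cosines fill [-1, 1]; the points 1 / (i + 1) there already give a nonzero difference more roots
    than its degree allows. *)
Lemma poly_cos_ext p q : (forall t, p.[cos t] = q.[cos t]) -> p = q.
Proof.
move=> h; apply/eqP; rewrite -subr_eq0; apply/negPn/negP => nz.
pose rs : seq R := [seq (i.+1%:R)^-1 | i <- iota 0 (size (p - q))].
suff ha : all (root (p - q)) rs.
  have := @max_poly_roots _ _ rs nz ha; rewrite size_map size_iota ltnn.
  suff -> : uniq rs by move=> /(_ isT).
  rewrite map_inj_uniq ?iota_uniq // => i j /invr_inj /eqP.
  by rewrite eqr_nat => /eqP [].
apply/allP => _ /mapP[i _ ->].
have le1 : i.+1%:R^-1 <= 1 :> R by rewrite invf_le1 ?ltr0n // ler1n.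
have ge0 : 0 <= i.+1%:R^-1 :> R by rewrite invr_ge0.
move: le1 ge0; set z := i.+1%:R^-1 => le1 ge0.
rewrite /root -(@acosK R z); last by rewrite in_itv /=; apply/andP; split; lra.
by rewrite hornerD hornerN h subrr.
Qed.

Inductive cone : {poly R} -> Prop :=
| cone1 : cone 1
| coneL al be p : 0 <= be -> be <= al -> cone p -> cone ((al%:P + be *: 'X) * p)
| coneD p q : cone p -> cone q -> cone (p + q)
| coneZ c p : 0 <= c -> cone p -> cone (c *: p).

Lemma cone_ge0 p : cone p -> forall s, -1 <= s <= 1 -> 0 <= p.[s].
Proof.
elim=> [|al be {}p b0 ba _ IH|{}p q _ IHp _ IHq|c {}p c0 _ IH] s hs.
- by rewrite hornerC.
- rewrite hornerM mulr_ge0 ?IH // hornerD hornerC hornerZ hornerX.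
  by case/andP: hs => h1 h2; nra.
- by rewrite hornerD addr_ge0 ?IHp ?IHq.
- by rewrite hornerZ mulr_ge0 ?IH.
Qed.

(** Product rule for divided differences: if p = p(s) + (X - s) G, then (al + be X) p has quotient
    be p + (al + be s) G, and al + be s >= 0 for s in [-1, 1]. *)
Lemma cone_quotient p : cone p -> forall s, -1 <= s <= 1 ->
  exists2 G, cone G & p = p.[s]%:P + ('X - s%:P) * G.
Proof.
elim=> [|al be {}p b0 ba cp IH|{}p q _ IHp _ IHq|c {}p c0 _ IH] s hs.
- exists (0 *: 1); first exact: coneZ cone1.
  by rewrite hornerC scale0r mulr0 addr0.
- have [G cG pE] := IH _ hs.
  exists (be *: p + (al + be * s) *: G).
    by apply: coneD; apply: coneZ => //; case/andP: hs => h1 h2; nra.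
  have key (P A B S X C H : {poly R}) : P = C + (X - S) * H ->
      (A + B * X) * P = (A + B * S) * C + (X - S) * (B * P + (A + B * S) * H).
    by move=> ->; ring.
  rewrite hornerM hornerD hornerC hornerZ hornerX.
  by rewrite -!mul_polyC !polyCM polyCD polyCM; apply: key.
- have [G cG pE] := IHp _ hs; have [H cH qE] := IHq _ hs.
  exists (G + H); first exact: coneD.
  by rewrite {1}pE {1}qE hornerD polyCD; ring.
- have [G cG pE] := IH _ hs.
  exists (c *: G); first exact: coneZ.
  by rewrite {1}pE hornerZ scalerDr -scalerAr -!mul_polyC polyCM.
Qed.

(* Newton interpolation: the divided differences of a product of affine
   functions that increase and stay nonnegative on [-1, 1] are nonnegative. *)
Lemma cone_newton (ss : seq R) F : cone F ->
  (forall s, s \in ss -> -1 <= s <= 1) ->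
  exists p Q, [/\ (size p <= size ss)%N, cone Q &
    F = p + (\prod_(s <- ss) ('X - s%:P)) * Q].
Proof.
elim: ss F => [|s ss IH] F cF hs.
  by exists 0, F; rewrite size_poly0 big_nil mul1r add0r.
have [G cG FE] := cone_quotient cF (hs s (mem_head _ _)).
have [|p [Q [sp cQ GE]]] := IH G cG.
  by move=> u us; apply: hs; rewrite in_cons us orbT.
exists (F.[s]%:P + ('X - s%:P) * p), Q; split=> //.
  rewrite (leq_trans (size_polyD _ _)) // geq_max.
  rewrite (leq_trans (size_polyC_leq1 _)) //=.
  rewrite (leq_trans (size_polyMleq _ _)) // size_XsubC add2n /=.
  by rewrite ltnS.
by rewrite big_cons {1}FE GE; ring.
Qed.

(** Nodes other than 1 and -1 are listed twice, for j and a - j: the interpolation is of Hermite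
    type, tangent at these nodes, so that the nodal polynomial does not change sign on [-1, 1]. *)
Definition nodes a : seq R := [seq cos (2 * pi / a%:R * j%:R) | j <- iota 0 a].
Definition nodal a : {poly R} := \prod_(s <- nodes a) ('X - s%:P).

Lemma size_nodal a : size (nodal a) = a.+1.
Proof. by rewrite size_prod_XsubC size_map size_iota. Qed.

Lemma cheb_nodal a : (0 < a)%N -> cheb a = 1 + (2 ^+ a / 2) *: nodal a.
Proof.
move=> a0; apply: poly_cos_ext => t.
rewrite horner_cheb hornerD hornerC hornerZ horner_prod big_map.
have ordE (F : nat -> R) : \prod_(j <- iota 0 a) F j = \prod_(j < a) F j.
  by rewrite -(big_mkord xpredT) /index_iota subn0.
under [in RHS]eq_bigr do rewrite hornerXsubC.
rewrite ordE; have := prod_cos_roots t a0.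
under eq_bigr do rewrite -mulrBr.
rewrite big_split /= prodr_const card_ord.
move: (\prod_(j < a) _) => B h.
by rewrite mulrAC h; field.
Qed.

(** F minus its remainder is [nodal a] times an element of the cone. The latter is nonnegative on
    [-1, 1], and at cos t the former is a positive multiple of cos(a t) - 1. *)
Lemma cone_modp a F : (0 < a)%N -> cone F ->
  forall t, F.[cos t] <= (F %% nodal a).[cos t].
Proof.
move=> a0 cF t.
have ht s : -1 <= cos (s : R) <= 1 by rewrite cos_geN1 cos_le1.
have [|p [Q [sp cQ FE]]] := @cone_newton (nodes a) F cF.
  by move=> s /mapP[j _ ->].
have pE : F %% nodal a = p.
  apply/esym; apply: (@modpP _ _ Q); first by rewrite FE addrC mulrC.
  by rewrite size_nodal ltnS (leq_trans sp) // size_map size_iota.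
rewrite pE {1}FE hornerD hornerM gerDl.
apply: mulr_le0_ge0; last exact: cone_ge0.
have := congr1 (horner^~ (cos t)) (cheb_nodal a0).
rewrite horner_cheb hornerD hornerC hornerZ => h.
have := cos_le1 (a%:R * t); rewrite h gerDl pmulr_rle0 //.
Qed.

(** The alternative n < m is where the truncated difference n - m would break the identity. *)
Lemma chebD m n : cheb (n + m) + cheb (n - m)%N = 2%:P * cheb n * cheb m \/ (n < m)%N.
Proof.
have [nm|mn] := ltnP n m; [by right|left].
apply: poly_cos_ext => t.
rewrite hornerD !hornerM hornerC !horner_cheb natrD natrB // mulrDl mulrBl.
by rewrite cosD cosB; ring.
Qed.

(** Modulo [nodal a] one has T_a = 1, hence T_{n+a} + T_{n-a} = 2 T_n: along a progression of step a
    the residues are affine in l. The formula is the affine function with value T_r at l = 0 and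
    T_{r-a} = T_{a-r} at l = -1. *)
Lemma cheb_modp_progression a l r : (0 < a)%N -> (r <= a)%N ->
  cheb (l * a + r) %% nodal a =
  (l.+1%:R *: cheb r - l%:R *: cheb (a - r)) %% nodal a.
Proof.
move=> a0 ra.
have ch1 p : (cheb a * p) %% nodal a = p %% nodal a.
  rewrite cheb_nodal // mulrDl mul1r -scalerAl modpD modpZl.
  by rewrite modp_mulr scaler0 addr0.
suff : cheb (l * a + r) %% nodal a =
  (l.+1%:R *: cheb r - l%:R *: cheb (a - r)) %% nodal a /\
  cheb (l.+1 * a + r) %% nodal a =
  (l.+2%:R *: cheb r - l.+1%:R *: cheb (a - r)) %% nodal a by case.
elim: l => [|l [IH1 IH2]].
  split; first by rewrite mul0n add0n scale1r scale0r subr0.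
  have [h|] := chebD r a; last by rewrite ltnNge ra.
  have -> : cheb (1 * a + r) = 2%:P * cheb a * cheb r - cheb (a - r).
    by rewrite -h mul1n addrK.
  by rewrite !modpD -mulrA mul_polyC !modpZl ch1 !modpN scale1r.
split=> //.
have [h|] := chebD a (l.+1 * a + r); last by rewrite ltnNge -addnA mulSn -addnA leq_addr.
have -> : cheb (l.+2 * a + r) = 2%:P * cheb a * cheb (l.+1 * a + r) - cheb (l * a + r).
  have e1 : (l.+2 * a + r = l.+1 * a + r + a)%N by rewrite !mulSn; lia.
  have e2 : (l * a + r = l.+1 * a + r - a)%N by rewrite !mulSn; lia.
  by rewrite e1 e2 -mulrA (mulrC (cheb a)) mulrA -h addrK.
rewrite modpD -mulrA mul_polyC modpZl ch1 modpN IH1 IH2.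
rewrite !(modpD, modpN, modpZl) !scaler_nat; ring.
Qed.

Lemma cheb_modp_node a l : (0 < a)%N -> cheb (l * a) %% nodal a = 1.
Proof.
move=> a0; have := cheb_modp_progression l a0 (leq0n a).
rewrite addn0 subn0 => ->.
rewrite modpD modpN !modpZl (cheb_nodal a0) modpD modpZl modpp scaler0 addr0.
rewrite {1}/cheb /= -scalerBl -natrB // subSnn scale1r modp_small //.
by rewrite size_poly1 size_nodal ltnS.
Qed.

Lemma cheb_modp_lt a l r : (0 < a)%N -> (0 < r < a)%N ->
  cheb (l * a + r) %% nodal a = l.+1%:R *: cheb r - l%:R *: cheb (a - r).
Proof.
move=> a0 /andP[r0 ra]; rewrite cheb_modp_progression // 1?ltnW //.
rewrite modp_small // size_nodal ltnS (leq_trans (size_polyD _ _)) // geq_max.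
rewrite size_polyN !(leq_trans (size_scale_leq _ _)) //.
  by rewrite (leq_trans (size_cheb _)) // -subSn ?(ltnW ra) // leq_subLR; lia.
exact: leq_trans (size_cheb _) _.
Qed.

End Chebyshev.

Section Gauss.
Variable R : realType.
Implicit Types Q q t : R.

(** The Q-integer is kept as a geometric sum, without the quotient by 1 - Q, because the value Q = 1
    is used too. *)
Definition qnum Q n : R := \sum_(i < n) Q ^+ i.
Definition qfact Q n : R := \prod_(i < n) qnum Q i.+1.

(** Gaussian binomial coefficient [M, j] in base Q, by the Q-Pascal rule. *)
Fixpoint gauss Q (M j : nat) : R :=
  match M, j with
  | _, 0 => 1
  | 0, _.+1 => 0
  | M'.+1, j'.+1 => gauss Q M' j' + Q ^+ j'.+1 * gauss Q M' j'.+1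
  end.

Lemma qnumS Q n : qnum Q n.+1 = qnum Q n + Q ^+ n.
Proof. by rewrite /qnum big_ord_recr. Qed.

Lemma qnumSl Q n : qnum Q n.+1 = 1 + Q * qnum Q n.
Proof.
rewrite /qnum big_ord_recl expr0 mulr_sumr; congr (_ + _).
by apply: eq_bigr => i _; rewrite exprS.
Qed.

Lemma qnum_ge0 Q n : 0 <= Q -> 0 <= qnum Q n.
Proof. by move=> Q0; apply: sumr_ge0 => i _; rewrite exprn_ge0. Qed.

Lemma qnumS_gt0 Q n : 0 <= Q -> 0 < qnum Q n.+1.
Proof. by move=> Q0; rewrite qnumSl ltr_pwDl // mulr_ge0 // qnum_ge0. Qed.

Lemma gaussn0 Q M : gauss Q M 0 = 1.
Proof. by case: M. Qed.

Lemma gauss_small Q M j : (M < j)%N -> gauss Q M j = 0.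
Proof.
elim: M j => [|M IH] [|j] //= h.
by rewrite !IH // ?mulr0 ?addr0 // ltnW.
Qed.

Lemma gauss_gt0 Q M j : 0 <= Q -> (j <= M)%N -> 0 < gauss Q M j.
Proof.
move=> Q0; elim: M j => [|M IH] [|j] //= h.
have [/IH h2|h2] := leqP j.+1 M.
  by rewrite ltr_pwDl ?IH // mulr_ge0 ?exprn_ge0 // ltW.
by rewrite (gauss_small _ h2) mulr0 addr0 IH.
Qed.

Lemma gauss_ratio Q M j :
  qnum Q j.+1 * gauss Q M j.+1 = qnum Q (M - j) * gauss Q M j.
Proof.
elim: M j => [|M IH] [|j]; rewrite /= ?mulr0.
- by rewrite /qnum big_ord0 mul0r.
- by [].
- have q1 : qnum Q 1 = 1 by rewrite qnumSl /qnum big_ord0 mulr0 addr0.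
  have := IH 0%N; rewrite !gaussn0 !subn0 !mulr1 expr1 q1 !mul1r => ->.
  by rewrite qnumSl.
rewrite subSS; have [jM|Mj] := ltnP j M; last first.
  by rewrite (@gauss_small _ M j.+1) // (@gauss_small _ M j.+2) ?ltnS 1?leqW // !mulr0 !addr0 mulr0 (eqP (_ : M - j == 0)%N) ?subn_eq0 // /qnum big_ord0 mul0r.
have h1 := IH j; have h2 := IH j.+1.
transitivity (qnum Q j.+2 * gauss Q M j.+1 +
    Q ^+ j.+2 * (qnum Q j.+2 * gauss Q M j.+2)); first by ring.
transitivity (qnum Q (M - j) * gauss Q M j +
    Q ^+ j.+1 * qnum Q (M - j) * gauss Q M j.+1); last by ring.
rewrite h2 -h1 [qnum Q j.+2]qnumS.
have -> : (M - j = (M - j.+1).+1)%N by lia.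
by rewrite (qnumSl _ (M - j.+1)) !exprS; ring.
Qed.

Lemma gauss_fact Q M j : (j <= M)%N ->
  gauss Q M j * (qfact Q j * qfact Q (M - j)) = qfact Q M.
Proof.
elim: j => [|j IH] jM; first by rewrite gaussn0 subn0 /qfact big_ord0 !mul1r.
rewrite -IH 1?ltnW //.
have fS n : qfact Q n.+1 = qfact Q n * qnum Q n.+1 by rewrite /qfact big_ord_recr.
have := gauss_ratio Q M j.
have -> : (M - j = (M - j.+1).+1)%N by lia.
rewrite !fS; move: (gauss Q M j) (gauss Q M j.+1) => g g' h.
transitivity (qfact Q j * qfact Q (M - j.+1) * (qnum Q j.+1 * g')); first by ring.
by rewrite h; ring.
Qed.

Lemma gauss_sym Q M j : 0 <= Q -> (j <= M)%N -> gauss Q M (M - j) = gauss Q M j.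
Proof.
move=> Q0 jM; have f0 n : qfact Q n != 0.
  by rewrite gt_eqF // prodr_gt0 // => i _; apply: qnumS_gt0.
apply: (mulIf (mulf_neq0 (f0 j) (f0 (M - j)%N))).
by rewrite gauss_fact // [X in _ * X]mulrC -{3}(subKn jM) gauss_fact // leq_subr.
Qed.

(** Cauchy's Q-binomial theorem. Splitting off the factor n = 0 leaves the same product at Q x, and
    the Q-Pascal rule matches the coefficients. *)
Lemma qbinomial Q M (x : R[i]) :
  \prod_(n < M) (1 + (Q ^+ n)%:C * x) =
  \sum_(j < M.+1) (Q ^+ 'C(j, 2) * gauss Q M j)%:C * x ^+ j.
Proof.
elim: M x => [|M IH] x.
  by rewrite big_ord0 big_ord_recl big_ord0 /= expr0 mul1r addr0 mulr1.
rewrite big_ord_recl expr0 mul1r.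
have -> : \prod_(i < M) (1 + (Q ^+ lift ord0 i)%:C * x) =
          \prod_(i < M) (1 + (Q ^+ i)%:C * (Q%:C * x)).
  by apply: eq_bigr => i _; rewrite /= exprSr rmorphM /= mulrA.
rewrite IH mulrDl mul1r [RHS]big_ord_recl [X in X + _]big_ord_recl.
rewrite /= bin0n !gaussn0 !expr0 -addrA; congr (_ + _).
have -> : \sum_(i < M) (Q ^+ 'C(lift ord0 i, 2) * gauss Q M (lift ord0 i))%:C *
    (Q%:C * x) ^+ lift ord0 i =
  \sum_(i < M.+1) (Q ^+ 'C(i.+1, 2) * gauss Q M i.+1)%:C * (Q%:C * x) ^+ i.+1.
  by rewrite [RHS]big_ord_recr /= (gauss_small _ (ltnSn M)) mulr0 mul0r addr0.
rewrite mulr_sumr -big_split; apply: eq_bigr => i _ /=.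
rewrite binS bin1 exprMn exprD [x ^+ i.+1]exprS exprMn.
rewrite -!(rmorphXn, rmorphM) /=.
rewrite !(rmorphM, rmorphD, rmorphXn) /= exprS; ring.
Qed.

Lemma bin2_double j : (2 * 'C(j, 2) + j = j * j)%N.
Proof. by elim: j => [|j IH] //; rewrite binS bin1; lia. Qed.

Lemma prod_odd_pow q N : \prod_(m < N) q ^+ (2 * m).+1 = q ^+ (N * N).
Proof.
elim: N => [|N IH]; first by rewrite big_ord0.
by rewrite big_ord_recr /= IH -exprD; congr (_ ^+ _); lia.
Qed.

(** This is [qbinomial] in base q^2 with 2N factors at x = q^(1 - 2N) e^{it}, whose exponents are
    the odd numbers from 1 - 2N to 2N - 1. The negative ones are turned over by q^u (1 + q^{-u}
    e^{it}) = e^{it} (1 + q^u e^{-it}); this accounts for the multiplier q^(N^2) e^{iNt}. The sum of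
    the two truncated differences encodes |i - N|. *)
Lemma gauss_product_cis q N t : 0 < q ->
  \prod_(m < N) ((1 + (q ^+ (2 * m).+1)%:C * cis t) *
                 (1 + (q ^+ (2 * m).+1)%:C * cis (- t))) =
  \sum_(i < (N + N).+1)
    (q ^+ ((i - N + (N - i)) ^ 2) * gauss (q ^+ 2) (N + N) i)%:C *
    cis ((i%:R - N%:R) * t).
Proof.
move=> q0; have qn k : q ^+ k != 0 by rewrite expf_neq0 // gt_eqF.
have qCn k : (q ^+ k)%:C != 0 :> R[i] by rewrite (inj_eq (@complexI R)) qn.
pose c := q / q ^+ (2 * N).
have := qbinomial (q ^+ 2) (N + N) (c%:C * cis t).
rewrite big_split_ord /= (reindex_inj rev_ord_inj) /= => h.
apply: (mulfI (mulf_neq0 (qCn (N * N)%N) (cis_neq0 (N%:R * t)))).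
rewrite !mulr_sumr.
transitivity ((q ^+ (N * N))%:C * (q ^+ (N * N))%:C *
   \sum_(j < (N + N).+1) ((q ^+ 2) ^+ 'C(j, 2) * gauss (q ^+ 2) (N + N) j)%:C * (c%:C * cis t) ^+ j).
  have hq : (q ^+ (N * N))%:C = \prod_(m < N) (q ^+ (2 * m).+1)%:C.
    by rewrite -rmorph_prod prod_odd_pow.
  have ht : cis (N%:R * t) = \prod_(m < N) cis t.
    by rewrite prodr_const card_ord cisMn.
  rewrite -h -mulrA -[RHS]mulrA; congr (_ * _).
  rewrite ht hq -!big_split /=; apply: eq_bigr => m _.
  rewrite mulrA; have qE (k : nat) : (q ^+ 2) ^+ k * c = q ^+ (2 * k).+1 / q ^+ (2 * N).
    by rewrite /c -exprM exprSr mulrA.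
  have -> : ((q ^+ 2) ^+ (N + m))%:C * (c%:C * cis t) = (q ^+ (2 * m).+1)%:C * cis t.
    rewrite mulrA -rmorphM /= qE; congr (_%:C * _).
    by apply: (mulIf (qn (2 * N)%N)); rewrite divfK // -exprD; congr (_ ^+ _); lia.
  have -> : (q ^+ (2 * m).+1)%:C * (1 + ((q ^+ 2) ^+ (N - m.+1))%:C * (c%:C * cis t)) =
      (q ^+ (2 * m).+1)%:C + cis t.
    rewrite mulrDr mulr1 !mulrA -!rmorphM /= -mulrA qE mulrA -exprD.
    have -> : ((2 * m).+1 + (2 * (N - m.+1)).+1 = 2 * N)%N.
      by have := ltn_ord m; lia.
    by rewrite divff // mul1r.
  transitivity ((1 + (q ^+ (2 * m).+1)%:C * cis t) *
    (cis t + (q ^+ (2 * m).+1)%:C * (cis t * cis (- t)))); first by ring.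
  by rewrite cisNK mulr1 addrC; ring.
rewrite mulr_sumr; apply: eq_bigr => j _.
set d := (j - N + (N - j))%N.
have cE : cis ((j%:R - N%:R) * t) = cis t ^+ j * cis (- (N%:R * t)).
  by rewrite mulrBl cisD cisMn.
have -> : (q ^+ (N * N))%:C * cis (N%:R * t) * ((q ^+ (d ^ 2) * gauss (q ^+ 2) (N + N) j)%:C *
   cis ((j%:R - N%:R) * t)) = (q ^+ (N * N) * (q ^+ (d ^ 2) * gauss (q ^+ 2) (N + N) j))%:C * cis t ^+ j.
  transitivity ((q ^+ (N * N))%:C * (q ^+ (d ^ 2) * gauss (q ^+ 2) (N + N) j)%:C *
    (cis t ^+ j * (cis (N%:R * t) * cis (- (N%:R * t))))).
    by rewrite cE; ring.
  by rewrite cisNK mulr1 -rmorphM.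
have cX : c%:C ^+ j = (c ^+ j)%:C by rewrite rmorphXn.
rewrite (exprMn _ c%:C) cX !mulrA -!rmorphM /=; congr (_%:C * _).
(* As 2 C(j, 2) + j = j^2, this is N^2 + j^2 = (j - N)^2 + 2 N j. *)
have e : q ^+ (N * N) * q ^+ (2 * 'C(j, 2)) * q ^+ j = q ^+ (d ^ 2) * q ^+ (2 * N * j).
  rewrite -!exprD; congr (_ ^+ _); have := bin2_double j.
  rewrite /d; case: (leqP j N) => jN.
    by rewrite (eqP (_ : j - N == 0)%N) ?subn_eq0 //; nia.
  by rewrite (eqP (_ : N - j == 0)%N) ?subn_eq0 1?ltnW //; nia.
rewrite /c expr_div_n -!exprM.
apply: (mulIf (qn (2 * N * j)%N)).
transitivity (q ^+ (N * N) * gauss (q ^+ 2) (N + N) j * (q ^+ (N * N) * q ^+ (2 * 'C(j, 2)) * q ^+ j)).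
  by field.
by rewrite e; ring.
Qed.

(* Ratio of the [Q]-binomials [2N, N + k] and [2N, N]. For [Q = q ^ 2] this
   tends to [1]; at [Q = 1] these are the cosine coefficients of the positive
   kernel [(2 + 2 cos t) ^ N] normalised to have mean [1]. *)
Definition kwt Q N k : R := \prod_(i < k) (qnum Q (N - i) / qnum Q (N + i).+1).

Lemma gauss_kwt Q N k : 0 <= Q ->
  gauss Q (N + N) (N + k) = gauss Q (N + N) N * kwt Q N k.
Proof.
move=> Q0; elim: k => [|k IH]; first by rewrite addn0 /kwt big_ord0 mulr1.
rewrite /kwt big_ord_recr /= -/(kwt Q N k) mulrA -IH addnS.
have n0 : qnum Q (N + k).+1 != 0 by rewrite gt_eqF // qnumS_gt0.
apply: (mulfI n0); rewrite gauss_ratio subnDl.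
by rewrite [RHS]mulrC mulrA divfK // mulrC.
Qed.

Lemma kwt_ge0 Q N k : 0 <= Q -> 0 <= kwt Q N k.
Proof. by move=> Q0; apply: prodr_ge0 => i _; rewrite divr_ge0 ?qnum_ge0. Qed.

Lemma qnum_le Q m n : 0 <= Q -> (m <= n)%N -> qnum Q m <= qnum Q n.
Proof.
move=> Q0 mn; rewrite -(subnKC mn) /qnum big_split_ord /= lerDl sumr_ge0 // => i _.
by rewrite exprn_ge0.
Qed.

Lemma kwt_le1 Q N k : 0 <= Q -> kwt Q N k <= 1.
Proof.
move=> Q0; apply: prodr_ile1 => i _; rewrite divr_ge0 ?qnum_ge0 //=.
rewrite ler_pdivrMr ?qnumS_gt0 // mul1r qnum_le //.
by rewrite (leq_trans (leq_subr _ _)) // -addnS leq_addr.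
Qed.

Lemma kwt_small Q N k : (N < k)%N -> kwt Q N k = 0.
Proof.
move=> Nk; rewrite /kwt (bigD1 (Ordinal Nk)) //= subnn /qnum big_ord0.
by rewrite !mul0r.
Qed.

(** Numerator and denominator differ by 2i + 1 powers of Q, each at most Q^(N - i), while the
    denominator contains N - i powers that are at least Q^(N - i). The bound does not involve Q and
    so includes Q = 1. *)
Lemma qnum_ratio_ge Q N i : 0 < Q <= 1 -> (i < N)%N ->
  1 - (i.*2.+1)%:R / (N - i)%:R <= qnum Q (N - i) / qnum Q (N + i).+1.
Proof.
move=> /andP[Q0 Q1] iN; have Q0' := ltW Q0.
have n0 : 0 < (N - i)%:R :> R by rewrite ltr0n subn_gt0.
have d0 : 0 < qnum Q (N + i).+1 by exact: qnumS_gt0.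
rewrite ler_pdivlMr // mulrBl mul1r lerBlDl -lerBlDr.
have -> : qnum Q (N + i).+1 - qnum Q (N - i) =
   \sum_(j < i.*2.+1) Q ^+ (N - i + j).
  have -> : (N + i).+1 = (N - i + i.*2.+1)%N by lia.
  by rewrite /qnum big_split_ord /= addrAC subrr add0r.
have le1 : \sum_(j < i.*2.+1) Q ^+ (N - i + j) <= (i.*2.+1)%:R * Q ^+ (N - i).
  rewrite mulr_natl -[X in _ *+ X]card_ord -sumr_const ler_sum // => j _.
  by rewrite ler_wiXn2l // leq_addr.
have le2 : (N - i)%:R * Q ^+ (N - i) <= qnum Q (N + i).+1.
  apply: le_trans (_ : qnum Q (N - i) <= _); last by apply: qnum_le => //; lia.
  rewrite mulr_natl -[X in _ *+ X]card_ord -sumr_const ler_sum // => j _.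
  by rewrite ler_wiXn2l // ltnW.
by rewrite (le_trans le1) // -mulrA ler_wpM2l // mulrC ler_pdivlMr // mulrC.
Qed.

Lemma cvg_kwt Q k : 0 < Q <= 1 -> kwt Q N k @[N --> \oo] --> (1 : R).
Proof.
move=> hQ; have Q0 : 0 <= Q by case/andP: hQ => /ltW.
elim: k => [|k IH].
  by rewrite (_ : (fun _ => _) = fun=> 1); [exact: cvg_cst|apply/funext => N; rewrite /kwt big_ord0].
rewrite (_ : (fun N => _) = fun N => kwt Q N k * (qnum Q (N - k) / qnum Q (N + k).+1)); last first.
  by apply/funext => N; rewrite /kwt big_ord_recr.
rewrite -[X in _ --> X](mulr1 (1 : R)); apply: cvgM => //.
apply: (@squeeze_cvgr _ _ _ _ (fun N => 1 - (k.*2.+1)%:R / (N - k)%:R) (fun=> 1)).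
- near=> N; apply/andP; split.
    by apply: qnum_ratio_ge => //; near: N; exact: nbhs_infty_gt.
  rewrite ler_pdivrMr ?qnumS_gt0 // mul1r qnum_le //.
  by rewrite (leq_trans (leq_subr _ _)) // -addnS leq_addr.
- rewrite -[X in _ --> X](subr0 (1 : R)); apply: cvgB; first exact: cvg_cst.
  rewrite -(cvg_shiftn k.+1) /=.
  have -> : (fun N => (k.*2.+1)%:R / (N + k.+1 - k)%:R) = (fun N => (k.*2.+1)%:R * @harmonic R N).
    by apply/funext => N /=; rewrite addnS subSn ?leq_addl // addnK.
  have h0 : (k.*2.+1)%:R * @harmonic R N @[N --> \oo] --> (k.*2.+1)%:R * (0 : R).
    by apply: cvgM; [exact: cvg_cst|exact: cvg_harmonic].
  by rewrite mulr0 in h0.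
- exact: cvg_cst.
Unshelve. all: by end_near. Qed.

(** The number of integers of absolute value k. *)
Definition eps k : R := if k is 0 then 1 else 2.

(** The even trigonometric polynomial whose Fourier coefficient at n is c |n| for |n| < L. *)
Definition csum L (c : nat -> R) t : R :=
  \sum_(k < L) eps k * c k * cos (k%:R * t).

(** Frequencies k and -k carry equal coefficients by [gauss_sym]. Once the central binomial
    coefficient is factored out, the k-th one is q^(k^2) up to the correction [kwt]. *)
Lemma gauss_product_cos q N t : 0 < q ->
  \prod_(m < N) (1 + q ^+ (2 * m).+1 ^+ 2 + 2 * q ^+ (2 * m).+1 * cos t) =
  gauss (q ^+ 2) (N + N) N *
    csum N.+1 (fun k => q ^+ (k ^ 2) * kwt (q ^+ 2) N k) t.
Proof.
move=> q0; have Q0 : 0 <= q ^+ 2 by rewrite exprn_ge0 // ltW.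
transitivity (complex.Re (\prod_(m < N) ((1 + (q ^+ (2 * m).+1)%:C * cis t) *
                 (1 + (q ^+ (2 * m).+1)%:C * cis (- t))))).
  rewrite (eq_bigr (fun m : 'I_N => (1 + q ^+ (2 * m).+1 ^+ 2 + 2 * q ^+ (2 * m).+1 * cos t)%:C)).
    by rewrite -rmorph_prod.
  move=> m _; set u := q ^+ _.
  have h := cisNK t.
  transitivity (1 + u%:C * (cis t + cis (- t)) + u%:C * u%:C * (cis t * cis (- t))).
    by ring.
  by rewrite h cisDN mulr1 !(rmorphM, rmorphD, rmorphXn, rmorph1) /=; ring.
rewrite gauss_product_cis // Re_sum -addnS big_split_ord /= big_ord_recl.
rewrite (reindex_inj rev_ord_inj) /= addrCA -big_split /=.
rewrite /csum big_ord_recl /= mulrDr; congr (_ + _).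
  rewrite /= !addn0 subnn !subrr !mul0r cos0 /kwt big_ord0 -[((0 + 0) ^ 2)%N]/0%N.
  by rewrite ?expr0; ring.
rewrite mulr_sumr; apply: eq_bigr => k _ /=.
have e1 : (N - k.+1 - N + (N - (N - k.+1)) = k.+1)%N by have := ltn_ord k; lia.
have e2 : (N + bump 0 k - N + (N - (N + bump 0 k)) = k.+1)%N by rewrite /bump; lia.
have kN : (k.+1 <= N)%N by exact: ltn_ord.
rewrite e1 e2 /bump /= add1n !mul0r !subr0.
have -> : (N + k.+1)%:R - N%:R = k.+1%:R :> R by rewrite natrD addrC addKr.
have -> : (N - k.+1)%:R - N%:R = - k.+1%:R :> R by rewrite natrB // addrAC subrr sub0r.
have -> : gauss (q ^+ 2) (N + N) (N - k.+1) = gauss (q ^+ 2) (N + N) (N + k.+1).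
  by rewrite -(@gauss_sym _ _ (N + k.+1)) ?leq_add2l // subnDl.
rewrite mulNr cosN gauss_kwt //; ring.
Qed.

Lemma csum_widen L L' c t : (L <= L')%N ->
  (forall k, (L <= k)%N -> c k = 0) -> csum L' c t = csum L c t.
Proof.
move=> LL c0; rewrite -(subnKC LL) /csum big_split_ord /= [X in _ + X]big1 ?addr0 //.
by move=> i _; rewrite c0 ?leq_addr // mulr0 mul0r.
Qed.

(* The discrete average over [M] equidistant points stands for the convolution
   integral; it is exact as soon as [M] exceeds the sum of the degrees. *)
Lemma csum_conv_ge0 L (b c : nat -> R) :
  (forall t, 0 <= csum L b t) -> (forall t, 0 <= csum L c t) ->
  forall t, 0 <= csum L (fun k => c k * b k) t.
Proof.
move=> hb hc x; pose M := L.*2.+1.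
have M0 : 0 < M%:R :> R by rewrite ltr0n.
suff -> : csum L (fun k => c k * b k) x = M%:R^-1 *
   \sum_(s < M) csum L b (2 * pi * (s%:R / M%:R)) * csum L c (x - 2 * pi * (s%:R / M%:R)).
  apply: mulr_ge0; first by rewrite invr_ge0 ltW.
  by apply: sumr_ge0 => s _; rewrite mulr_ge0.
apply: (mulfI (lt0r_neq0 M0)).
rewrite mulrA mulfV ?mul1r ?gt_eqF //.
under eq_bigr do rewrite /csum big_distrlr /=.
rewrite exchange_big /= mulr_sumr; apply: eq_bigr => k _.
rewrite exchange_big /=.
transitivity (\sum_(l < L) (if l == k then M%:R * (eps k * (c k * b k) * cos (k%:R * x)) else 0)).
  by rewrite -big_mkcond big_pred1_eq.
apply: eq_bigr => l _.
transitivity (eps k * b k * (eps l * c l) / 2 *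
  ((\sum_(s < M) cos (l%:R * x + 2 * pi * (k%:Z - l%:Z)%:~R * (s%:R / M%:R))) +
   (\sum_(s < M) cos (l%:R * x + 2 * pi * (- (k%:Z + l%:Z))%:~R * (s%:R / M%:R))))); last first.
  rewrite -big_split mulr_sumr; apply: eq_bigr => s _ /=.
  set u := s%:R / M%:R.
  have -> : l%:R * x + 2 * pi * (k%:Z - l%:Z)%:~R * u = l%:R * (x - 2 * pi * u) + k%:R * (2 * pi * u).
    by rewrite intrB -!pmulrn; ring.
  have -> : l%:R * x + 2 * pi * (- (k%:Z + l%:Z))%:~R * u = l%:R * (x - 2 * pi * u) - k%:R * (2 * pi * u).
    by rewrite intrN intrD -!pmulrn; ring.
  rewrite cosD cosB; by field.
(* Both frequencies k - l and -(k + l) are smaller than M in absolute value, so divisibility by M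
   means being zero. Only l = k survives, counted twice when k = 0, in accordance with [eps]. *)
rewrite !sum_cos_roots //.
have hk := ltn_ord k; have hl := ltn_ord l.
have d1 : (M%:Z %| k%:Z - l%:Z)%Z = (l == k).
  rewrite -val_eqE /=; apply/idP/eqP => [|->]; last by rewrite subrr dvdz0.
  move=> /dvdzP[z hz]; have : z = 0 by rewrite /M in hz; nia.
  by lia.
have d2 : (M%:Z %| - (k%:Z + l%:Z))%Z = (l == k) && (k == 0 :> nat)%N.
  rewrite -val_eqE /=; apply/idP/andP => [|[/eqP -> /eqP ->]]; last by rewrite oppr0 dvdz0.
  move=> /dvdzP[z hz]; have : z = 0 by rewrite /M in hz; nia.
  by move=> z0; split; apply/eqP; lia.
rewrite d1 d2; case: eqVneq => [->|_] /=; last by rewrite addr0 mulr0.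
by case: (nat_of_ord k) => [|m] /=; rewrite ?mul0r ?cos0 /eps; field.
Qed.

End Gauss.

(** * The interpolating majorant of a Gaussian cosine series *)

Section Majorant.
Variable R : realType.
Implicit Types q t : R.

Definition tpoly q N : {poly R} :=
  \prod_(m < N) ((1 + q ^+ (2 * m).+1 ^+ 2)%:P + (2 * q ^+ (2 * m).+1) *: 'X).

Definition tcoef q N k : R := q ^+ (k ^ 2) * kwt (q ^+ 2) N k.

(** The condition be <= al of the cone reads 2 u <= 1 + u^2 for u = q^(2m + 1). *)
Lemma cone_tpoly q N : 0 < q -> cone (tpoly q N).
Proof.
move=> q0; rewrite /tpoly; elim: N => [|N IH]; first by rewrite big_ord0; exact: cone1.
rewrite big_ord_recr /= mulrC; apply: coneL => //.
  by rewrite mulr_ge0 // exprn_ge0 // ltW.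
have := sqr_ge0 (q ^+ (2 * N).+1 - 1); move: (q ^+ _) => u h; nra.
Qed.

Lemma tpolyE q N : 0 < q -> tpoly q N =
  gauss (q ^+ 2) (N + N) N *: \sum_(k < N.+1) (eps R k * tcoef q N k) *: cheb R k.
Proof.
move=> q0; apply: poly_cos_ext => t.
rewrite hornerZ horner_sum horner_prod.
under eq_bigr do rewrite hornerD hornerC hornerZ hornerX.
rewrite gauss_product_cos //; congr (_ * _).
by apply: eq_bigr => k _; rewrite hornerZ horner_cheb.
Qed.

(* Cosine coefficients of the interpolating majorant of a cosine series with
   coefficients [w]. *)
Definition mcoef (w : nat -> R) a L r : R :=
  if r is 0 then \sum_(l < L) eps R l * w (l * a)%N
  else if (r < a)%N then
    \sum_(l < L) (l.+1%:R * w (l * a + r)%N - l%:R * w (l * a + (a - r))%N)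
  else 0.

Lemma sum_ord_mul (V : zmodType) (F : nat -> V) L a :
  \sum_(k < L * a) F k = \sum_(l < L) \sum_(r < a) F (l * a + r)%N.
Proof.
elim: L => [|L IH]; first by rewrite !big_ord0.
by rewrite mulSnr big_split_ord /= IH big_ord_recr.
Qed.

Lemma tcoef_small q N k : (N < k)%N -> tcoef q N k = 0.
Proof. by move=> h; rewrite /tcoef kwt_small // mulr0. Qed.

(** Every frequency is written l a + r and reduced by the progression formula. Exchanging r and a -
    r in the subtracted part collects the coefficient of cos(r t) and produces the second sum in
    [mcoef]. *)
Lemma horner_tpoly_modp q N a t : 0 < q -> (0 < a)%N ->
  (tpoly q N %% nodal R a).[cos t] =
  gauss (q ^+ 2) (N + N) N * csum a (mcoef (tcoef q N) a N.+1) t.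
Proof.
move=> q0 a0; rewrite tpolyE // modpZl hornerZ; congr (_ * _).
pose w := tcoef q N.
have -> : \sum_(k < N.+1) (eps R k * tcoef q N k) *: cheb R k =
          \sum_(k < N.+1 * a) (eps R k * w k) *: cheb R k.
  (* The range is padded with zero coefficients to a multiple of a, so that it splits into full
     residue systems. *)
  have h : (N.+1 <= N.+1 * a)%N by rewrite leq_pmulr.
  rewrite -(subnKC h) big_split_ord /= [X in _ = _ + X]big1 ?addr0 //.
  by move=> i _; rewrite /w tcoef_small ?mulr0 ?scale0r // leq_addr.
rewrite (sum_ord_mul (fun k => (eps R k * w k) *: cheb R k)).
have modp_sum I (r : seq I) (F : I -> {poly R}) :
    (\sum_(i <- r) F i) %% nodal R a = \sum_(i <- r) (F i %% nodal R a).
  by rewrite (big_morph (fun p => p %% nodal R a) (modpD _) (mod0p _)).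
rewrite modp_sum; case: a a0 @w modp_sum => // A _ w modp_sum.
rewrite horner_sum /csum [RHS]big_ord_recl /= mul0r cos0 mulr1 mul1r.
transitivity (\sum_(l < N.+1) (eps R l * w (l * A.+1)%N +
   \sum_(r < A) 2 * (l.+1%:R * w (l * A.+1 + r.+1)%N - l%:R * w (l * A.+1 + (A.+1 - r.+1))%N) * cos (r.+1%:R * t))).
  apply: eq_bigr => l _; rewrite modp_sum horner_sum big_ord_recl /= addn0.
  rewrite modpZl cheb_modp_node // hornerZ hornerC mulr1.
  have -> : eps R (l * A.+1) = eps R l by case: (nat_of_ord l) => // k; rewrite mulSn.
  congr (_ + _).
  transitivity (\sum_(r < A) (2 * l.+1%:R * w (l * A.+1 + r.+1)%N * cos (r.+1%:R * t)) -
    \sum_(r < A) (2 * l%:R * w (l * A.+1 + r.+1)%N * cos ((A.+1 - r.+1)%:R * t))).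
    rewrite -sumrB; apply: eq_bigr => r _; rewrite /bump /= add1n.
    rewrite modpZl cheb_modp_lt ?ltnS ?ltn_ord // hornerZ hornerD hornerN !hornerZ !horner_cheb.
    rewrite addnS /= -addnS; ring.
  rewrite [X in _ - X](reindex_inj rev_ord_inj) /= -sumrB.
  apply: eq_bigr => r _; have rA := ltn_ord r.
  have -> : (A.+1 - (A - r.+1).+1 = r.+1)%N by lia.
  have -> : ((A - r.+1).+1 = A.+1 - r.+1)%N by lia.
  by ring.
rewrite big_split /=; congr (_ + _).
rewrite exchange_big /=; apply: eq_bigr => r _; rewrite /bump /= add1n.
by rewrite ltnS ltn_ord -mulr_suml -mulr_sumr.
Qed.

Lemma tcoef_majorant_ge0 q N a t : 0 < q -> (0 < a)%N ->
  0 <= csum N.+1 (tcoef q N) t /\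
  csum N.+1 (tcoef q N) t <= csum a (mcoef (tcoef q N) a N.+1) t.
Proof.
move=> q0 a0; have g0 : 0 < gauss (q ^+ 2) (N + N) N.
  by rewrite gauss_gt0 ?leq_addr // exprn_ge0 // ltW.
have tE : (tpoly q N).[cos t] = gauss (q ^+ 2) (N + N) N * csum N.+1 (tcoef q N) t.
  rewrite tpolyE // hornerZ horner_sum; congr (_ * _).
  by apply: eq_bigr => k _; rewrite hornerZ horner_cheb.
split.
  rewrite -(pmulr_rge0 _ g0) -tE; apply: cone_ge0; first exact: cone_tpoly.
  by rewrite cos_geN1 cos_le1.
by rewrite -(ler_pM2l g0) -tE -horner_tpoly_modp // cone_modp //; exact: cone_tpoly.
Qed.

Lemma csumB L (b c : nat -> R) t :
  csum L (fun k => b k - c k) t = csum L b t - csum L c t.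
Proof. by rewrite /csum -sumrB; apply: eq_bigr => k _; ring. Qed.

Lemma mcoef_small w a L r : (0 < a)%N -> (a <= r)%N -> mcoef w a L r = 0.
Proof.
by case: r => [|r]; [case: a|move=> _ ar; rewrite /mcoef ltnNge ar].
Qed.

(** Convolution with a nonnegative [c] preserves both inequalities and leaves a number of terms
    independent of N, so that the limit in N can be taken coefficient by coefficient. *)
Lemma tcoef_kernel_ge0 q N a L (c : nat -> R) : 0 < q -> (0 < a)%N ->
  (forall k, (L <= k)%N -> c k = 0) -> (forall t, 0 <= csum L c t) ->
  forall t, 0 <= csum L (fun k => c k * tcoef q N k) t /\
    csum L (fun k => c k * tcoef q N k) t <=
    csum L (fun k => c k * mcoef (tcoef q N) a N.+1 k) t.
Proof.
move=> q0 a0 c0 hc t; set w := tcoef q N; set m := mcoef _ _ _.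
pose M := maxn L (maxn N.+1 a).
have LM : (L <= M)%N by exact: leq_maxl.
have NM : (N.+1 <= M)%N by rewrite leq_max (leq_maxl N.+1) orbT.
have aM : (a <= M)%N by rewrite leq_max (leq_maxr N.+1) orbT.
have cM t' : 0 <= csum M c t' by rewrite (csum_widen t' LM c0).
have wM t' : csum M w t' = csum N.+1 w t'.
  by apply: csum_widen => // k; exact: tcoef_small.
have mM t' : csum M m t' = csum a m t'.
  by apply: csum_widen => // k; exact: mcoef_small.
have cut (b : nat -> R) t' : csum M (fun k => c k * b k) t' = csum L (fun k => c k * b k) t'.
  by apply: csum_widen => // k /c0 ->; rewrite mul0r.
split.
  rewrite -cut; apply: csum_conv_ge0 => // t'.
  by rewrite wM; case: (tcoef_majorant_ge0 N t' q0 a0).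
rewrite -!cut -subr_ge0 -csumB.
rewrite (_ : (fun k => _) = (fun k => c k * (m k - w k))); last first.
  by apply/funext => k; rewrite mulrBr.
apply: csum_conv_ge0 => // t'.
by rewrite csumB wM mM subr_ge0; case: (tcoef_majorant_ge0 N t' q0 a0).
Qed.

(** * Passage to the limit: from the finite product to theta series *)

Lemma cvg_sumr n (F : 'I_n -> nat -> R) (l : 'I_n -> R) :
  (forall i, F i N @[N --> \oo] --> l i) ->
  \sum_(i < n) F i N @[N --> \oo] --> \sum_(i < n) l i.
Proof.
move=> h; apply: cvg_big => [x|i _]; last exact: h.
exact: add_continuous.
Qed.

Lemma cvg_csum L (c : nat -> nat -> R) (d : nat -> R) t :
  (forall k, c N k @[N --> \oo] --> d k) ->
  csum L (c N) t @[N --> \oo] --> csum L d t.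
Proof.
move=> h; rewrite /csum; apply: cvg_sumr => k.
by apply: cvgM; [apply: cvgM; [exact: cvg_cst|exact: h]|exact: cvg_cst].
Qed.

(** Dominated convergence for series: the full series bounds the weighted sums from above, and a
    fixed initial segment bounds them from below. *)
Lemma tannery (v : nat -> R) (b : nat -> nat -> R) :
  (forall l, 0 <= v l) -> cvgn (series v) ->
  (forall N l, 0 <= b N l <= 1) -> (forall l, b N l @[N --> \oo] --> (1 : R)) ->
  \sum_(l < N.+1) b N l * v l @[N --> \oo] --> limn (series v).
Proof.
move=> v0 cv hb b1; apply/cvgrPdist_le => e e0.
have e2 : 0 < e / 2 by rewrite divr_gt0.
have nd : nondecreasing_seq (series v).
  by apply/nondecreasing_seqP => n; rewrite seriesSr lerDl.
have sle n : series v n <= limn (series v) by exact: nondecreasing_cvgn_le.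
have [K _ hK] : \forall n \near \oo, `|limn (series v) - series v n| <= e / 2.
  by have /cvgrPdist_le := cv; exact.
have hKK := hK K (leqnn K).
have cK : \sum_(l < K) b N l * v l @[N --> \oo] --> series v K.
  have -> : series v K = \sum_(l < K) 1 * v l.
    by rewrite seriesEord; apply: eq_bigr => i _; rewrite mul1r.
  apply: cvg_sumr => k; apply: cvgM; [exact: b1|exact: cvg_cst].
have h2 : \forall N \near \oo, `|series v K - \sum_(l < K) b N l * v l| <= e / 2.
  by have /cvgrPdist_le := cK; exact.
near=> N.
have NK : (K <= N.+1)%N by rewrite ltnW // ltnS; near: N; exact: nbhs_infty_ge.
have hN : `|series v K - \sum_(l < K) b N l * v l| <= e / 2 by near: N.
have up : \sum_(l < N.+1) b N l * v l <= limn (series v).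
  apply: le_trans (sle N.+1); rewrite seriesEord ler_sum // => i _.
  by rewrite ler_piMl // ; case/andP: (hb N i).
have lo : \sum_(l < K) b N l * v l <= \sum_(l < N.+1) b N l * v l.
  rewrite -(subnKC NK) big_split_ord /= lerDl sumr_ge0 // => i _.
  by rewrite mulr_ge0 //; case/andP: (hb N (K + i)%N).
rewrite ger0_norm ?subr_ge0 //.
move: hN hKK; rewrite !ler_norml => /andP[h3 h4] /andP[h5 h6]; lra.
Unshelve. all: by end_near. Qed.

Lemma is_cvg_gauss_series q a r : 0 < q < 1 -> (0 < a)%N ->
  cvgn (series (fun l => l.+1%:R * q ^+ ((l * a + r) ^ 2)) : R^nat).
Proof.
move=> /andP[q0 q1] a0; have q0' := ltW q0.
(* The sum of the series of (l + 1) q^l, which dominates termwise because l <= (l a + r)^2. *)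
pose B := (1 - q) ^- 2.
apply: nondecreasing_is_cvgn.
  apply/nondecreasing_seqP => n; rewrite seriesSr lerDl mulr_ge0 //.
  by rewrite exprn_ge0.
exists B => _ [n _ <-].
apply: le_trans (_ : series (fun l => l.+1%:R * q ^+ l) n <= _).
  rewrite !seriesEord; apply: ler_sum => i _; rewrite ler_wpM2l //.
  apply: ler_wiXn2l; rewrite ?ltW //.
  by rewrite (leq_trans (leq_pmulr i a0)) // (leq_trans (leq_addr r _)) // -[X in (X <= _)%N]expn1; case: (_ + _)%N => // m; rewrite leq_pexp2l.
have s0 : 0 < 1 - q by rewrite subr_gt0.
have -> : B = (1 - q) ^- 2 by [].
rewrite -[X in _ <= X]mul1r ler_pdivlMr ?exprn_gt0 //.
suff -> : series (fun l => l.+1%:R * q ^+ l) n * (1 - q) ^+ 2 =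
   1 - n.+1%:R * q ^+ n + n%:R * q ^+ n.+1.
  have qn := exprn_ge0 n q0'.
  rewrite exprS -[n.+1%:R]natr1; have n0 := mulr_ge0 (mulr_ge0 (ler0n R n) qn) (ltW s0).
  nra.
rewrite seriesEord /=; elim: n => [|n IH].
  by rewrite big_ord0 expr0 !mul0r mulr1 subrr addr0.
rewrite big_ord_recr /= mulrDl IH -[n.+2%:R]natr1 -[n.+1%:R]natr1 !exprS; ring.
Qed.

(* The limit of [mcoef] as [L] tends to infinity, for [w k = q ^ (k ^ 2)]. *)
Definition mser q a r : R :=
  if r is 0 then 1 + 2 * limn (series (fun l => q ^+ ((l.+1 * a) ^ 2)))
  else if (r < a)%N then
    limn (series (fun l => l.+1%:R * q ^+ ((l * a + r) ^ 2))) -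
    limn (series (fun l => l%:R * q ^+ ((l * a + (a - r)) ^ 2)))
  else 0.

Lemma is_cvg_gauss_series_le q a r (c : nat -> R) : 0 < q < 1 -> (0 < a)%N ->
  (forall l, 0 <= c l <= l.+1%:R) ->
  cvgn (series (fun l => c l * q ^+ ((l * a + r) ^ 2)) : R^nat).
Proof.
move=> hq a0 hc; have q0 : 0 <= q by case/andP: hq => /ltW.
apply: (@series_le_cvg _ _ (fun l => l.+1%:R * q ^+ ((l * a + r) ^ 2)));
  last exact: is_cvg_gauss_series; move=> l.
- by rewrite mulr_ge0 ?exprn_ge0 //; case/andP: (hc l).
- by rewrite mulr_ge0 ?exprn_ge0.
- by rewrite ler_wpM2r ?exprn_ge0 //; case/andP: (hc l).
Qed.

Lemma cvg_tcoef q k : 0 < q < 1 -> tcoef q N k @[N --> \oo] --> q ^+ (k ^ 2).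
Proof.
move=> /andP[q0 q1]; rewrite -[X in _ --> X]mulr1.
apply: cvgM; [exact: cvg_cst|apply: cvg_kwt].
by rewrite exprn_gt0 //= expr_le1 // ltW.
Qed.

(** The base Q is left free: Q = q^2 gives the limit of the finite triple products, Q = 1 that of
    the lattice means of the kernel means. *)
Lemma cvg_mcoef_kwt q Q a r : 0 < q < 1 -> 0 < Q <= 1 -> (0 < a)%N ->
  mcoef (fun k => q ^+ (k ^ 2) * kwt Q N k) a N.+1 r @[N --> \oo] --> mser q a r.
Proof.
move=> hq Q2 a0; have /andP[q0 q1] := hq; have q0' := ltW q0.
have Q0 : 0 <= Q by case/andP: Q2 => /ltW.
pose w N k := q ^+ (k ^ 2) * kwt Q N k.
have tan (c : nat -> R) s : (forall l, 0 <= c l <= l.+1%:R) ->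
   \sum_(l < N.+1) c l * w N (l * a + s)%N @[N --> \oo] -->
   limn (series (fun l => c l * q ^+ ((l * a + s) ^ 2))).
  move=> hc.
  have -> : (fun N => \sum_(l < N.+1) c l * w N (l * a + s)%N) =
     (fun N => \sum_(l < N.+1) kwt Q N (l * a + s) * (c l * q ^+ ((l * a + s) ^ 2))).
    by apply/funext => N; apply: eq_bigr => l _; rewrite /w; ring.
  apply: (@tannery _ (fun N l => kwt Q N (l * a + s))).
  - by move=> l; rewrite mulr_ge0 ?exprn_ge0 //; case/andP: (hc l).
  - exact: is_cvg_gauss_series_le.
  - by move=> N l; rewrite kwt_ge0 // kwt_le1.
  - by move=> l; exact: cvg_kwt.
case: r => [|r]; rewrite /mcoef /mser.
  have -> : (fun N => \sum_(l < N.+1) eps R l * w N (l * a)%N) =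
    (fun N => 1 + 2 * \sum_(l < N) w N (l.+1 * a)%N).
    apply/funext => N; rewrite big_ord_recl /= mul0n mul1r /w.
    rewrite /kwt big_ord0 expr0 mulr1 mulr_sumr; congr (_ + _).
  apply: cvgD; first exact: cvg_cst.
  apply: cvgM; first exact: cvg_cst.
  have h := @tannery (fun l => q ^+ ((l.+1 * a) ^ 2)) (fun N l => kwt Q N (l.+1 * a)).
  have h1 : \sum_(l < N.+1) kwt Q N (l.+1 * a) * q ^+ ((l.+1 * a) ^ 2) @[N --> \oo] -->
     limn (series (fun l => q ^+ ((l.+1 * a) ^ 2))).
    apply: h.
    - by move=> l; rewrite exprn_ge0.
    - have := @is_cvg_gauss_series_le q a a (fun=> 1) hq a0.
      under eq_fun do rewrite mul1r addnC -mulSn.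
      by apply=> l; rewrite ler01 ler1n.
    - by move=> N l; rewrite kwt_ge0 // kwt_le1.
    - by move=> l; exact: cvg_kwt.
  (* The sums differ by the term l = N, whose weight vanishes because N < (N + 1) a. *)
  apply: cvg_trans h1; apply: near_eq_cvg; near=> N.
  rewrite big_ord_recr /= kwt_small ?mul0r ?addr0; last by rewrite leq_pmulr.
  by apply: eq_bigr => l _; rewrite /w mulrC.
case: ifPn => [ra|_]; last exact: cvg_cst.
under eq_fun do rewrite sumrB.
apply: cvgB; apply: tan => l; first by rewrite ler0n lexx.
by rewrite ler0n ler_nat leqnSn.
Unshelve. all: by end_near. Qed.

Lemma cvg_mcoef q a r : 0 < q < 1 -> (0 < a)%N ->
  mcoef (tcoef q N) a N.+1 r @[N --> \oo] --> mser q a r.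
Proof.
move=> hq a0; apply: cvg_mcoef_kwt => //; have /andP[q0 q1] := hq.
by rewrite exprn_gt0 //= expr_le1 // ltW.
Qed.

Theorem mser_majorant q a L (c : nat -> R) : 0 < q < 1 -> (0 < a)%N ->
  (forall k, (L <= k)%N -> c k = 0) -> (forall t, 0 <= csum L c t) ->
  forall t, 0 <= csum L (fun k => c k * q ^+ (k ^ 2)) t /\
    csum L (fun k => c k * q ^+ (k ^ 2)) t <= csum L (fun k => c k * mser q a k) t.
Proof.
move=> hq a0 c0 hc t; have q0 : 0 < q by case/andP: hq.
have A : csum L (fun k => c k * tcoef q N k) t @[N --> \oo] -->
         csum L (fun k => c k * q ^+ (k ^ 2)) t.
  apply: cvg_csum => k; apply: cvgM; [exact: cvg_cst|exact: cvg_tcoef].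
have B : csum L (fun k => c k * mcoef (tcoef q N) a N.+1 k) t @[N --> \oo] -->
         csum L (fun k => c k * mser q a k) t.
  apply: cvg_csum => k; apply: cvgM; [exact: cvg_cst|exact: cvg_mcoef].
have hN N := tcoef_kernel_ge0 N q0 a0 c0 hc t.
split; first by apply: (cvgr_to_ge A); near=> N; case: (hN N).
by apply: (ler_cvg_to A B); near=> N; case: (hN N).
Unshelve. all: by end_near. Qed.

End Majorant.

(** * Integration on the torus and Fourier coefficients *)

Section TorusIntegral.
Variable R : realType.
Let RT := measurableTypeR R.

(** Such functions form an algebra and are integrable for the probability [torus_measure], so
    integrability never needs a separate estimate. *)
Definition bmeas d (f : 'rV[R]_d -> R) :=
  measurable_fun [set: d.-tuple RT] (fun t => f (row_of_tuple t)) /\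
  exists M, forall x, `|f x| <= M.

Lemma cvg_row d (u : nat -> 'rV[R]_d) (x : 'rV[R]_d) :
  (forall j, u n 0 j @[n --> \oo] --> x 0 j) -> u n @[n --> \oo] --> x.
Proof.
move=> h; apply/cvg_ballP => e e0.
have : \forall n \near \oo, forall j, ball (x 0 j) e (u n 0 j).
  apply: filter_forall => j; have /cvg_ballP := h j; exact.
apply: filterS => n hn; split=> // i j; rewrite (ord1 i); exact: hn.
Qed.

(** The sigma-algebra on tuples is the product one, whereas continuity refers to the topology of row
    vectors. The bridge is to sample f on the grid of mesh 1 / (n + 1): the samples are constant on
    countably many measurable boxes and converge to f pointwise. *)
Lemma measurable_row d (f : 'rV[R]_d -> R) : continuous f ->
  measurable_fun [set: d.-tuple RT] (fun t => f (row_of_tuple t)).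
Proof.
move=> cf.
pose g (n : nat) (k : 'rV[int]_d) : R := f (\row_j ((k 0 j)%:~R / n.+1%:R)).
pose k (n : nat) (t : d.-tuple RT) : 'rV[int]_d := \row_j Num.floor (n.+1%:R * tnth t j).
apply: (@measurable_fun_cvg _ _ _ _ (fun n t => g n (k n t))) => [n|t _].
- move=> _ B mB; rewrite setTI.
  have -> : (fun t => g n (k n t)) @^-1` B =
    \bigcup_(m in [set m | B (g n m)]) \bigcap_(j in [set: 'I_d])
       ((fun t : d.-tuple RT => n.+1%:R * tnth t j : RT) @^-1`
         `[(m 0 j)%:~R, (m 0 j + 1)%:~R[%classic).
    apply/seteqP; split=> [t /= Bt|t [m /= Bm hm]].
      by exists (k n t) => // j _; rewrite /= in_itv /= mxE floor_itv.
    suff -> : k n t = m by [].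
    by apply/rowP => j; rewrite mxE; apply: floor_def; have := hm j I; rewrite /= in_itv.
  rewrite bigcup_mkcond; apply: countable_bigcupT_measurable => [|m]; first exact: countableP.
  case: ifP => // _; apply: fin_bigcap_measurable => // j _.
  rewrite -[X in measurable X]setTI.
  have mj : measurable_fun [set: d.-tuple RT] (fun t : d.-tuple RT => n.+1%:R * tnth t j : RT).
    by apply: measurable_funM; [exact: measurable_cst|exact: measurable_tnth].
  exact: mj.
- apply: (@cvg_comp _ _ _ (fun n => \row_j ((k n t 0 j)%:~R / n.+1%:R)) f _ (nbhs (row_of_tuple t))); last exact: cf.
  apply: cvg_row => j.
  apply: (@squeeze_cvgr _ _ _ _ (fun n => tnth t j - @harmonic R n) (fun=> tnth t j)).
  + near=> n; rewrite !mxE; have n0 : 0 < n.+1%:R :> R by rewrite ltr0n.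
    have /andP[h1 h2] := floor_itv (n.+1%:R * tnth t j).
    rewrite ler_pdivrMr // (mulrC (tnth t j)) h1 andbT ler_pdivlMr // mulrBl mulVf ?gt_eqF //.
    by rewrite intrD in h2; lra.
  + rewrite mxE -[X in _ --> X]subr0; apply: cvgB; first exact: cvg_cst.
    exact: cvg_harmonic.
  + by rewrite mxE; exact: cvg_cst.
Unshelve. all: by end_near. Qed.

Lemma bounded_integrable_prob disp (T : measurableType disp) (P : probability T R)
    (f : T -> R) : measurable_fun setT f -> (exists M, forall x, `|f x| <= M) ->
  P.-integrable setT (EFin \o f).
Proof.
move=> mf [M hM]; apply: measurable_bounded_integrable => //.
  exact: (eq_ind_r (fun z => (z < +oo)%E) (ltry 1) (probability_setT P)).
exists M; split; first exact: num_real.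
by move=> x Mx t _ /=; apply: le_trans (hM _) (ltW Mx).
Qed.

Lemma Rintegral_prob_cst disp (T : measurableType disp) (P : probability T R) (c : R) :
  (\int[P]_x c)%R = c.
Proof.
rewrite Rintegral_cst //.
exact: etrans (congr1 (fun z => c * fine z) (probability_setT P)) (mulr1 c).
Qed.

Lemma bmeas_integrable d (f : 'rV[R]_d -> R) : bmeas f ->
  (torus_measure R d).-integrable [set: _] (EFin \o (fun t => f (row_of_tuple t))).
Proof.
move=> [mf [M hM]]; apply: bounded_integrable_prob => //.
by exists M => x; exact: hM.
Qed.

Lemma bmeasD d (f g : 'rV[R]_d -> R) : bmeas f -> bmeas g -> bmeas (fun x => f x + g x).
Proof.
move=> [mf [M hM]] [mg [M' hM']]; split; first exact: measurable_funD.
exists (M + M') => x; apply: le_trans (ler_normD _ _) _; exact: lerD.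
Qed.

Lemma bmeasM d (f g : 'rV[R]_d -> R) : bmeas f -> bmeas g -> bmeas (fun x => f x * g x).
Proof.
move=> [mf [M hM]] [mg [M' hM']]; split; first exact: measurable_funM.
by exists (M * M') => x; rewrite normrM ler_pM.
Qed.

Lemma bmeas_cst d (c : R) : bmeas (fun _ : 'rV[R]_d => c).
Proof. by split; [exact: measurable_cst|exists `|c|]. Qed.

Lemma bmeasN d (f : 'rV[R]_d -> R) : bmeas f -> bmeas (fun x => - f x).
Proof.
move=> hf; have := bmeasM (bmeas_cst d (-1)) hf.
by congr bmeas; apply/funext => x; rewrite mulN1r.
Qed.

Lemma bmeasB d (f g : 'rV[R]_d -> R) : bmeas f -> bmeas g -> bmeas (fun x => f x - g x).
Proof. by move=> hf hg; apply: bmeasD => //; exact: bmeasN. Qed.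

Lemma bmeas_norm d (f : 'rV[R]_d -> R) : bmeas f -> bmeas (fun x => `|f x|).
Proof.
move=> [mf [M hM]]; split; first exact: measurableT_comp.
by exists M => x; rewrite normr_id.
Qed.

Lemma bmeas_sum d I (r : seq I) (P : pred I) (F : I -> 'rV[R]_d -> R) :
  (forall i, bmeas (F i)) -> bmeas (fun x => \sum_(i <- r | P i) F i x).
Proof.
move=> h; elim: r => [|i r IH].
  by under eq_fun do rewrite big_nil; exact: bmeas_cst.
under eq_fun do rewrite big_cons; case: (P i) => //; exact: bmeasD.
Qed.

Lemma measurable_dotZ d (n : 'rV[int]_d) :
  measurable_fun [set: d.-tuple RT] (fun t => dotZ n (row_of_tuple t)).
Proof.
apply: measurable_sum => j; apply: measurable_funM; first exact: measurable_cst.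
under eq_fun do rewrite mxE; exact: measurable_tnth.
Qed.

Lemma bmeas_cos d (c : R) (n : 'rV[int]_d) :
  bmeas (fun x => cos (c + 2 * pi * dotZ n x)).
Proof.
split; last by exists 1 => x; exact: cos_max.
apply: measurableT_comp; first exact: continuous_measurable_fun (@continuous_cos R).
apply: measurable_funD; first exact: measurable_cst.
by apply: measurable_funM; [exact: measurable_cst|exact: measurable_dotZ].
Qed.

Lemma torus_intD d (f g : 'rV[R]_d -> R) : bmeas f -> bmeas g ->
  torus_int (fun x => f x + g x) = torus_int f + torus_int g.
Proof. by move=> hf hg; apply: RintegralD => //; exact: bmeas_integrable. Qed.

Lemma torus_intB d (f g : 'rV[R]_d -> R) : bmeas f -> bmeas g ->
  torus_int (fun x => f x - g x) = torus_int f - torus_int g.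
Proof. by move=> hf hg; apply: RintegralB => //; exact: bmeas_integrable. Qed.

Lemma torus_intZ d (f : 'rV[R]_d -> R) c : bmeas f ->
  torus_int (fun x => c * f x) = c * torus_int f.
Proof. by move=> hf; apply: RintegralZl => //; exact: bmeas_integrable. Qed.

Lemma torus_int_cst d (c : R) : torus_int (fun _ : 'rV[R]_d => c) = c.
Proof.
exact: Rintegral_prob_cst.
Qed.

Lemma le_torus_int d (f g : 'rV[R]_d -> R) : bmeas f -> bmeas g ->
  (forall x, f x <= g x) -> torus_int f <= torus_int g.
Proof.
by move=> hf hg h; apply: le_Rintegral => //; exact: bmeas_integrable.
Qed.

Lemma torus_int_sum d I (r : seq I) (P : pred I) (F : I -> 'rV[R]_d -> R) :
  (forall i, bmeas (F i)) ->
  torus_int (fun x => \sum_(i <- r | P i) F i x) = \sum_(i <- r | P i) torus_int (F i).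
Proof.
move=> h; elim: r => [|i r IH].
  by rewrite big_nil; under eq_fun do rewrite big_nil; exact: torus_int_cst.
rewrite big_cons; under eq_fun do rewrite big_cons.
case: (P i) => //; rewrite torus_intD ?IH //; exact: bmeas_sum.
Qed.

Definition row_cons d (x : R) (y : 'rV[R]_d) : 'rV[R]_d.+1 :=
  \row_j oapp (y 0) x (unlift ord0 j).

Lemma row_of_tuple_cons d (x : RT) (t : d.-tuple RT) :
  row_of_tuple (tuple_cons (x, t)) = row_cons x (row_of_tuple t).
Proof.
apply/rowP => j; rewrite !mxE; case: unliftP => [i ->|->] /=; last by [].
by rewrite mxE tnthS.
Qed.

Lemma torus_int_recl d (f : 'rV[R]_d.+1 -> R) : bmeas f ->
  torus_int f =
  (\int[uniform_prob (@ltr01 R)]_x torus_int (fun y => f (row_cons x y)))%R.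
Proof.
move=> [mf [M hM]]; rewrite /torus_int /Rintegral /=.
set P := (uniform_prob (@ltr01 R) \x torus_measure R d)%E.
have mfc : measurable_fun setT (fun p : RT * d.-tuple RT => f (row_of_tuple (tuple_cons p))).
  by apply: (measurableT_comp mf).
have ifc : P.-integrable setT (EFin \o (fun p => f (row_of_tuple (tuple_cons p)))).
  by apply: bounded_integrable_prob => //; exists M => x; exact: hM.
rewrite integral_distribution //; last exact/measurable_EFinP.
rewrite -(integral12_prod_meas1 ifc) /fubini_F; congr fine.
apply: eq_integral => x _ /=.
under eq_integral do rewrite row_of_tuple_cons.
rewrite fineK //; apply: integrable_fin_num => //.
apply: (@bounded_integrable_prob _ _ (torus_measure R d) (fun t => f (row_cons x (row_of_tuple t)))).
  under eq_fun do rewrite -row_of_tuple_cons.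
  by apply: (measurableT_comp mfc).
by exists M => y; exact: hM.
Qed.

Lemma integral_uniform_cos (c : R) (n : int) :
  (\int[uniform_prob (@ltr01 R)]_x cos (c + 2 * pi * (n%:~R * x)))%R =
  if n == 0 then cos c else 0.
Proof.
case: eqVneq => [->|n0].
  under eq_Rintegral do rewrite mul0r mulr0 addr0.
  exact: Rintegral_prob_cst.
pose al : R := 2 * pi * n%:~R.
have al0 : al != 0 by rewrite !mulf_neq0 ?intr_eq0 // gt_eqF // pi_gt0.
under eq_Rintegral do rewrite mulrA -/al.
have clin : continuous (fun x : R => c + al * x).
  move=> x; apply: continuousD; first exact: cst_continuous.
  by apply: continuousM; [exact: cst_continuous|exact: cvg_id].
have ccos : continuous (fun x : R => cos (c + al * x)).
  by move=> x; apply: (@continuous_comp _ _ _ (fun x => c + al * x)); [exact: clin|exact: continuous_cos].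
have c1cos : continuous (fun x : R => 1 + cos (c + al * x)).
  by move=> x; apply: continuousD; [exact: cst_continuous|exact: ccos].
have mc2 := continuous_measurable_fun ccos.
have mcos := continuous_measurable_fun c1cos.
have ge0 x : 0 <= 1 + cos (c + al * x).
  by have := cos_geN1 (c + al * x); lra.
(* Adding 1 makes the integrand nonnegative, as [integral_uniform] asks. *)
suff h : (\int[uniform_prob (@ltr01 R)]_x (1 + cos (c + al * x)) = 1)%R.
  move: h; rewrite RintegralD //.
  - by rewrite Rintegral_prob_cst => /(canRL (addKr _)) ->; rewrite addNr.
  - apply: bounded_integrable_prob; first exact: measurable_cst.
    by exists 1 => y; rewrite normr1.
  - by apply: bounded_integrable_prob => //; exists 1 => y; exact: cos_max.
rewrite /Rintegral integral_uniform //; last exact/measurable_EFinP.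
pose F (x : R) := x + al^-1 * sin (c + al * x).
have dF (x : R) : is_derive x 1 F (1 + cos (c + al * x)).
  have d1 : is_derive x 1 (fun x : R => c + al * x) al.
    by apply: is_derive_eq; rewrite -?[_ *: _]/(_ * _); ring.
  have d2 : is_derive x 1 (fun x : R => sin (c + al * x)) (al * cos (c + al * x)).
    have := @is_derive1_comp R (@sin R) (fun x : R => c + al * x) x _ _ (is_derive_sin _) d1.
    by rewrite -?[_ *: _]/(_ * _) mulrC.
  apply: is_derive_eq.
  by rewrite -?[_ *: _]/(_ * _); field.
have cF : continuous F.
  by move=> x; apply/differentiable_continuous/derivable1_diffP/ex_derive.
rewrite (@continuous_FTC2 _ _ F) //; last 3 first.
- exact: continuous_subspaceT.
- split=> [x _||].
  + exact/ex_derive.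
  + exact/cvg_at_right_filter/cF.
  + exact/cvg_at_left_filter/cF.
- by move=> x _; rewrite derive1E; apply: derive_val.
rewrite subr0 invr1 mul1e /= /F !mulr0 !addr0 add0r.
have -> : sin (c + al * 1) = sin c.
  have sE (z : R) : sin z = - cos (z + pi / 2) by rewrite cosDpihalf opprK.
  rewrite !sE; congr (- _); rewrite -[RHS](cos_periodz _ n); congr cos.
  by rewrite mulr1 /al; ring.
by ring.
Qed.

Lemma dotZ_row_cons d (n : 'rV[int]_d.+1) x (y : 'rV[R]_d) :
  dotZ n (row_cons x y) = (n 0 ord0)%:~R * x + dotZ (\row_j n 0 (lift ord0 j)) y.
Proof.
rewrite /dotZ big_ord_recl mxE unlift_none; congr (_ + _).
by apply: eq_bigr => j _; rewrite !mxE liftK.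
Qed.

(** The phase c makes the induction on d work: with the first coordinate fixed, its contribution is
    absorbed into the phase. *)
Lemma torus_int_cos d (c : R) (n : 'rV[int]_d) :
  torus_int (fun x => cos (c + 2 * pi * dotZ n x)) = if n == 0 then cos c else 0.
Proof.
elim: d c n => [|d IH] c n.
  have -> : n = 0 by apply/rowP => -[].
  rewrite eqxx -[RHS](torus_int_cst 0); congr torus_int.
  by apply/funext => x; rewrite /dotZ big_ord0 mulr0 addr0.
rewrite torus_int_recl; last exact: bmeas_cos.
have -> : (n == 0) = (n 0 ord0 == 0) && (\row_j n 0 (lift ord0 j) == 0).
  apply/eqP/andP => [->|[/eqP h /eqP h']].
    by rewrite mxE; split=> //; apply/eqP/rowP => j; rewrite !mxE.
  apply/rowP => j; rewrite mxE; case: (unliftP ord0 j) => [i ->|->] //.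
  by have := congr1 (fun r : 'rV_d => r 0 i) h'; rewrite !mxE.
under eq_Rintegral => x _.
  under eq_fun do rewrite dotZ_row_cons mulrDr addrA.
  rewrite IH; over.
set b := (\row_j n 0 (lift ord0 j) == 0); case: b.
  by rewrite andbT integral_uniform_cos.
by rewrite andbF; exact: Rintegral_prob_cst.
Qed.

Lemma cexp_im (p t : R) : cexp (2 * p%:C * 'i * t%:C) = cis (2 * p * t).
Proof.
have re0 : complex.Re (2 * p%:C * 'i * t%:C) = 0 by rewrite /=; ring.
have im0 : complex.Im (2 * p%:C * 'i * t%:C) = 2 * p * t by rewrite /=; ring.
by rewrite /cexp re0 im0 expR0 mul1r.
Qed.

Lemma fourier_integrand d (g : 'rV[R]_d -> R) k x :
  (g x)%:C * cexp (- (2 * pi%:C * 'i * (dotZ k x)%:C)) =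
  (g x * cos (2 * pi * dotZ k x)) +i* (- (g x * sin (2 * pi * dotZ k x))).
Proof.
rewrite -mulrN -rmorphN /= cexp_im /cis mulrN cosN sinN.
by move: (cos _) (sin _) (g x) => u v w; apply: eqcP; rewrite /=; ring.
Qed.

Lemma fourierE d (g : 'rV[R]_d -> R) k :
  fourier g k = torus_int (fun x => g x * cos (2 * pi * dotZ k x)) +i*
                torus_int (fun x => - (g x * sin (2 * pi * dotZ k x))).
Proof.
by rewrite /fourier /torus_cint; congr (_ +i* _); congr torus_int;
  apply/funext => x; rewrite fourier_integrand.
Qed.

Lemma bmeas_sin d (n : 'rV[int]_d) : bmeas (fun x => sin (2 * pi * dotZ n x)).
Proof.
have := bmeas_cos (- (pi / 2)) n.
by congr bmeas; apply/funext => x; rewrite addrC cosBpihalf.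
Qed.

Lemma Re_fourier d (g : 'rV[R]_d -> R) k :
  complex.Re (fourier g k) = torus_int (fun x => g x * cos (2 * pi * dotZ k x)).
Proof. by rewrite fourierE. Qed.

Lemma Im_fourier d (g : 'rV[R]_d -> R) k : bmeas g ->
  complex.Im (fourier g k) = - torus_int (fun x => g x * sin (2 * pi * dotZ k x)).
Proof.
move=> bg; rewrite fourierE; have := torus_intZ (-1) (bmeasM bg (bmeas_sin k)).
rewrite mulN1r => <-; congr torus_int.
by apply/funext => x; rewrite mulN1r.
Qed.

Lemma Zperiodic_bounded d (f : 'rV[R]_d -> R) : Zperiodic f -> continuous f ->
  exists M : R, forall x, `|f x| <= M.
Proof.
move=> pf cf.
pose A : set 'rV[R]_d := [set v | forall i, `[0, 1]%classic (v ord0 i)].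
have cA : compact A by apply: (@rV_compact R d (fun=> `[0, 1]%classic)) => i; exact: segment_compact.
have cfA : compact (f @` A).
  by apply: continuous_compact => //; exact: continuous_subspaceT.
have [M [_ hM]] := compact_bounded cfA.
exists (M + 1) => x.
pose n : 'rV[int]_d := \row_j - Num.floor (x 0 j).
rewrite -(pf x n); apply: (hM (M + 1)); first by rewrite ltrDl.
exists (x + map_mx intr n) => // i; rewrite /= in_itv /= !mxE mulrNz.
by have := floor_itv (x 0 i); rewrite intrD => /andP[h1 h2]; apply/andP; split; lra.
Qed.

Lemma bmeas_periodic d (f : 'rV[R]_d -> R) : Zperiodic f -> continuous f -> bmeas f.
Proof.
by move=> pf cf; split; [exact: measurable_row|exact: Zperiodic_bounded].
Qed.

End TorusIntegral.

(** * Product kernels and pointwise convergence of kernel means *)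

Section Korovkin.
Variable R : realType.
Implicit Types (c : nat -> R) (t : R).

(** Enumerates the frequencies with |n_j| <= N by a finite function type, the shape in which a
    product of sums over the coordinates expands. *)
Definition freq d N (f : {ffun 'I_d -> 'I_(N + N).+1}) : 'rV[int]_d :=
  \row_j ((f j)%:Z - N%:Z).

Lemma freq_inj d N : injective (@freq d N).
Proof.
move=> f g /rowP h; apply/ffunP => j; apply/val_inj => /=.
have := h j; rewrite !mxE; lia.
Qed.

Lemma freqP d N (n : 'rV[int]_d) : (forall j, (absz (n 0%R j) <= N)%N) ->
  exists f, freq (N := N) f = n.
Proof.
move=> h; exists [ffun j => inord (absz (n 0 j + N%:Z))].
apply/rowP => j; rewrite !mxE ffunE inordK; have := h j; lia.
Qed.

Lemma csum_cis N c t :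
  \sum_(i < (N + N).+1) (c `|i%:Z - N%:Z|%N)%:C * cis ((i%:Z - N%:Z)%:~R * t) =
  (csum N.+1 c t)%:C.
Proof.
rewrite -addnS big_split_ord /= big_ord_recl.
rewrite (reindex_inj rev_ord_inj) /= addrCA -big_split /=.
rewrite /csum big_ord_recl [in RHS]rmorphD rmorph_sum; congr (_ + _).
  by rewrite addn0 subrr absz0 !mul0r cis0 cos0 mul1r !mulr1.
apply: eq_bigr => k _; rewrite /=.
have kN : (k.+1 <= N)%N by exact: ltn_ord.
have -> : (N - k.+1)%:Z - N%:Z = - (k.+1)%:Z by lia.
have -> : (N + bump 0 k)%:Z - N%:Z = (k.+1)%:Z by rewrite /bump; lia.
rewrite abszN absz_nat /bump /= add1n mulrNz mulNr -mulrDr addrC cisDN -pmulrn.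
by rewrite -rmorphM /=; congr (_%:C); ring.
Qed.

Lemma dotZE d (n : 'rV[int]_d) (x : 'rV[R]_d) :
  2 * pi * dotZ n x = \sum_j (n 0 j)%:~R * (2 * pi * x 0 j).
Proof. by rewrite /dotZ mulr_sumr; apply: eq_bigr => j _; ring. Qed.

(** The expansion is done with exponentials, where the product over coordinates is a single
    exponential; the left side being real, taking real parts leaves the cosines. *)
Lemma prod_csum d N (c : 'I_d -> nat -> R) (x : 'rV[R]_d) :
  \prod_j csum N.+1 (c j) (2 * pi * x 0 j) =
  \sum_(f : {ffun 'I_d -> 'I_(N + N).+1})
    (\prod_j c j (absz (freq f 0 j))) * cos (2 * pi * dotZ (freq f) x).
Proof.
have E : (\prod_j csum N.+1 (c j) (2 * pi * x 0 j))%:C =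
    \sum_(f : {ffun 'I_d -> 'I_(N + N).+1})
      (\prod_j c j (absz (freq f 0 j)))%:C * cis (2 * pi * dotZ (freq f) x).
  rewrite rmorph_prod /=.
  under eq_bigr do rewrite -csum_cis.
  rewrite bigA_distr_bigA /=; apply: eq_bigr => f _.
  rewrite dotZE cis_sum rmorph_prod -big_split /=.
  by apply: eq_bigr => j _; rewrite mxE.
have := congr1 (@complex.Re R) E; rewrite Re_sum /= => ->.
by apply: eq_bigr => f _; rewrite /= mul0r subr0.
Qed.

Lemma dotZB d (n : 'rV[int]_d) (x y : 'rV[R]_d) : dotZ n (x - y) = dotZ n x - dotZ n y.
Proof. by rewrite /dotZ -sumrB; apply: eq_bigr => j _; rewrite !mxE mulrBr. Qed.

Lemma dotZDl d (n m : 'rV[int]_d) (x : 'rV[R]_d) : dotZ (n + m) x = dotZ n x + dotZ m x.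
Proof. by rewrite /dotZ -big_split; apply: eq_bigr => j _; rewrite !mxE intrD mulrDl. Qed.

Lemma dotZNl d (n : 'rV[int]_d) (x : 'rV[R]_d) : dotZ (- n) x = - dotZ n x.
Proof. by rewrite /dotZ -sumrN; apply: eq_bigr => j _; rewrite !mxE intrN mulNr. Qed.

Lemma dotZ0l d (x : 'rV[R]_d) : dotZ 0 x = 0.
Proof. by rewrite /dotZ big1 // => j _; rewrite mxE mul0r. Qed.

Definition kernel d N c (x : 'rV[R]_d) : R := \prod_j csum N.+1 c (2 * pi * x 0 j).

Lemma bmeas_cosB d (n : 'rV[int]_d) (x : 'rV[R]_d) :
  bmeas (fun y => cos (2 * pi * dotZ n (x - y))).
Proof.
have := bmeas_cos (2 * pi * dotZ n x) (- n).
by congr bmeas; apply/funext => y; rewrite dotZB dotZNl; congr cos; ring.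
Qed.

Lemma kernelE d N c (x y : 'rV[R]_d) : kernel N c (x - y) =
  \sum_(f : {ffun 'I_d -> 'I_(N + N).+1})
    (\prod_j c (absz (freq f 0 j))) * cos (2 * pi * dotZ (freq f) (x - y)).
Proof. exact: (prod_csum N (fun=> c)). Qed.

Lemma bmeas_kernel d N c (x : 'rV[R]_d) : bmeas (fun y => kernel N c (x - y)).
Proof.
under eq_fun do rewrite kernelE.
by apply: bmeas_sum => f; apply: bmeasM; [exact: bmeas_cst|exact: bmeas_cosB].
Qed.

Lemma torus_int_kernel d N c (h : 'rV[R]_d -> R) (x : 'rV[R]_d) : bmeas h ->
  torus_int (fun y => h y * kernel N c (x - y)) =
  \sum_(f : {ffun 'I_d -> 'I_(N + N).+1})
    (\prod_j c (absz (freq f 0 j))) * torus_int (fun y => h y * cos (2 * pi * dotZ (freq f) (x - y))).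
Proof.
move=> bh.
under eq_fun do rewrite kernelE mulr_sumr.
rewrite torus_int_sum; last first.
  move=> f; apply: bmeasM => //; apply: bmeasM; [exact: bmeas_cst|exact: bmeas_cosB].
apply: eq_bigr => f _; rewrite -torus_intZ; last by apply: bmeasM => //; exact: bmeas_cosB.
by congr torus_int; apply/funext => y; ring.
Qed.

Lemma torus_int_cosB d (h : 'rV[R]_d -> R) n (x : 'rV[R]_d) : bmeas h ->
  torus_int (fun y => h y * cos (2 * pi * dotZ n (x - y))) =
  complex.Re (fourier h n) * cos (2 * pi * dotZ n x) -
  complex.Im (fourier h n) * sin (2 * pi * dotZ n x).
Proof.
move=> bh; rewrite Re_fourier Im_fourier // mulNr opprK.
rewrite [X in X + _]mulrC [X in _ = _ + X]mulrC -torus_intZ; last first.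
  apply: bmeasM => //; have := bmeas_cos (0 : R) n.
  by congr bmeas; apply/funext => y; rewrite add0r.
rewrite -torus_intZ; last by apply: bmeasM => //; exact: bmeas_sin.
rewrite -torus_intD.
- by congr torus_int; apply/funext => y; rewrite dotZB mulrBr cosB; ring.
- apply: bmeasM; first exact: bmeas_cst.
  apply: bmeasM => //; have := bmeas_cos (0 : R) n.
  by congr bmeas; apply/funext => y; rewrite add0r.
- by apply: bmeasM; [exact: bmeas_cst|apply: bmeasM => //; exact: bmeas_sin].
Qed.

(** The convolution of [h] with [kernel N c], written through Fourier coefficients alone, since
    these are what is known of the gap. *)
Definition sigma d N c (h : 'rV[R]_d -> R) (x : 'rV[R]_d) : R :=
  \sum_(f : {ffun 'I_d -> 'I_(N + N).+1})
    (\prod_j c (absz (freq f 0 j))) *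
    (complex.Re (fourier h (freq f)) * cos (2 * pi * dotZ (freq f) x) -
     complex.Im (fourier h (freq f)) * sin (2 * pi * dotZ (freq f) x)).

Lemma sigmaE d N c (h : 'rV[R]_d -> R) x : bmeas h ->
  sigma N c h x = torus_int (fun y => h y * kernel N c (x - y)).
Proof.
move=> bh; rewrite torus_int_kernel //; apply: eq_bigr => f _.
by rewrite torus_int_cosB.
Qed.

Lemma torus_int_cos_cosB d (m n : 'rV[int]_d) (x : 'rV[R]_d) :
  torus_int (fun y => cos (2 * pi * dotZ m (x - y)) * cos (2 * pi * dotZ n (x - y))) =
  ((n == m)%:R + (n == - m)%:R) / 2.
Proof.
have I k (x0 : 'rV[R]_d) : torus_int (fun y => cos (2 * pi * dotZ k (x0 - y))) = (k == 0)%:R.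
  transitivity (torus_int (fun y => cos (2 * pi * dotZ k x0 + 2 * pi * dotZ (- k) y))).
    by congr torus_int; apply/funext => y; rewrite dotZB dotZNl; congr cos; ring.
  rewrite torus_int_cos oppr_eq0; case: eqP => // ->.
  by rewrite dotZ0l mulr0 cos0.
transitivity (torus_int (fun y => 2^-1 * (cos (2 * pi * dotZ (m - n) (x - y)) +
    cos (2 * pi * dotZ (m + n) (x - y))))).
  congr torus_int; apply/funext => y; rewrite !dotZDl dotZNl (mulrBr (2 * pi)) (mulrDr (2 * pi)) cosB cosD.
  by field.
rewrite torus_intZ; last by apply: bmeasD; exact: bmeas_cosB.
rewrite torus_intD; [|exact: bmeas_cosB|exact: bmeas_cosB].
rewrite !I subr_eq0 addr_eq0 (eq_sym m) -eqr_oppLR mulrC.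
by rewrite (eq_sym (- m)).
Qed.

Lemma torus_int_kernel1 d N c (x : 'rV[R]_d) : c 0%N = 1 ->
  torus_int (fun y => kernel N c (x - y)) = 1.
Proof.
move=> c0; have := torus_int_kernel N c x (bmeas_cst d (1 : R)).
under eq_fun do rewrite mul1r.
move=> ->; have [f0 f0E] : exists f, freq (d := d) (N := N) f = 0.
  by apply: freqP => j; rewrite mxE.
rewrite (bigD1 f0) //= [X in _ + X]big1 ?addr0 => [|f ff0].
  rewrite f0E big1 => [|j _]; last by rewrite mxE.
  have := torus_int_cos_cosB 0 0 x.
  rewrite oppr0 eqxx => hI; rewrite mul1r.
  transitivity ((true%:R + true%:R) / 2 : R); last by rewrite /=; field.
  rewrite -hI; congr torus_int; apply/funext => y.
  by rewrite dotZ0l mulr0 cos0.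
have := torus_int_cos_cosB 0 (freq f) x.
rewrite oppr0 -f0E (inj_eq (@freq_inj d N)) (negbTE ff0) addr0 mul0r => h.
rewrite -[RHS](mulr0 (\prod_j c (absz (freq f 0 j)))) -h; congr (_ * torus_int _).
apply/funext => y.
by rewrite f0E dotZ0l mulr0 cos0.
Qed.

(** Besides the total mass, this is the only moment that the concentration of the kernel depends
    on. *)
Lemma torus_int_kernel_cos d N c (x : 'rV[R]_d) i : c 0%N = 1 -> (0 < N)%N ->
  torus_int (fun y => cos (2 * pi * (x 0 i - y 0 i)) * kernel N c (x - y)) = c 1%N.
Proof.
move=> c0 N0; pose e : 'rV[int]_d := \row_j (j == i)%:Z.
have eE (y : 'rV[R]_d) : cos (2 * pi * (x 0 i - y 0 i)) = cos (2 * pi * dotZ e (x - y)).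
  congr (cos (_ * _)); rewrite /dotZ (bigD1 i) //= big1 => [|j ji]; last first.
    by rewrite mxE (negbTE ji) mul0r.
  by rewrite !mxE eqxx mul1r addr0.
under eq_fun do rewrite eE.
rewrite torus_int_kernel; last exact: bmeas_cosB.
have [f1 f1E] : exists f, freq (N := N) f = e.
  by apply: freqP => j; rewrite mxE; case: (j == i).
have [f2 f2E] : exists f, freq (N := N) f = - e.
  by apply: freqP => j; rewrite !mxE; case: (j == i).
have e0 : e != - e.
  by apply/eqP => /rowP/(_ i); rewrite !mxE eqxx.
have ce (n : 'rV[int]_d) : n = e \/ n = - e -> \prod_j c (absz (n 0 j)) = c 1%N.
  move=> h; rewrite (bigD1 i) //= big1 => [|j ji].
    by rewrite mulr1; case: h => ->; rewrite !mxE eqxx.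
  by case: h => ->; rewrite !mxE (negbTE ji).
have f12 : f2 != f1 by apply: contra e0 => /eqP h; rewrite -f2E h f1E.
rewrite (bigD1 f1) //= (bigD1 f2) //= [X in _ + (_ + X)]big1 => [|f /andP[h1 h2]].
  have E1 : \prod_j c (absz (e 0 j)) = c 1%N by apply: ce; left.
  have E2 : \prod_j c (absz ((- e) 0 j)) = c 1%N by apply: ce; right.
  rewrite !torus_int_cos_cosB f1E f2E E1 E2 !eqxx (eq_sym (- e)) (negbTE e0) /=.
  by field.
have h3 : (freq f == e) = false by rewrite -f1E (inj_eq (@freq_inj d N)) (negbTE h1).
have h4 : (freq f == - e) = false by rewrite -f2E (inj_eq (@freq_inj d N)) (negbTE h2).
by rewrite torus_int_cos_cosB h3 h4 addr0 mul0r mulr0.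
Qed.

(** The functions 1 - cos detect the distance to x modulo the integer lattice. Close to x continuity
    suffices; otherwise some coordinate makes 1 - cos at least [eta], and C = 2B / eta lets that
    term outweigh the oscillation 2B of h. *)
Lemma periodic_modulus d (h : 'rV[R]_d -> R) (x : 'rV[R]_d) (e : R) : Zperiodic h -> continuous h -> 0 < e ->
  exists2 C : R, 0 <= C & forall y : 'rV[R]_d, `|h y - h x| <= e + C * \sum_j (1 - cos (2 * pi * (x 0 j - y 0 j))).
Proof.
move=> ph ch e0.
have [B hB] := Zperiodic_bounded ph ch.
have B0 : 0 <= B by apply: le_trans (hB 0).
have [dl dl0 hdl] : exists2 dl : R, 0 < dl & forall y : 'rV[R]_d, (forall j, `|x 0 j - y 0 j| < dl) -> `|h x - h y| <= e.
  have /cvgrPdist_le/(_ _ e0)/nbhs_ballP[dl /= dl0 hd] := ch x.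
  by exists dl => // y hy; apply: hd; split=> // i j; rewrite (ord1 i); exact: hy.
pose del := Num.min dl (1 / 2).
have del0 : 0 < del by rewrite lt_min dl0; lra.
have delh : del <= 1 / 2 by rewrite ge_min lexx orbT.
have deld : del <= dl by rewrite ge_min lexx.
have pi0 := pi_gt0 R.
pose eta := 1 - cos (2 * pi * del).
have eta0 : 0 < eta.
  by rewrite subr_gt0; apply: cos_lt1; apply/andP; split; nra.
exists (2 * B / eta); first by rewrite divr_ge0 ?mulr_ge0 // ltW.
move=> y.
(* The integer vector nearest to x - y; the remainders [s j] lie in [-1/2, 1/2], so 2 pi |s j| stays
   in [0, pi], where cos decreases. *)
pose m : 'rV[int]_d := \row_j Num.floor (x 0 j - y 0 j + 1 / 2).
pose s j := x 0 j - y 0 j - (m 0 j)%:~R.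
have hs j : - (1 / 2) <= s j <= 1 / 2.
  rewrite /s mxE; have /andP[h1 h2] := floor_itv (x 0 j - y 0 j + 1 / 2).
  by rewrite intrD in h2; apply/andP; split; lra.
have cs j : cos (2 * pi * (x 0 j - y 0 j)) = cos (2 * pi * s j).
  rewrite -[RHS](cos_periodz _ (m 0 j)); congr cos; rewrite /s; ring.
have t0 j : 0 <= 1 - cos (2 * pi * (x 0 j - y 0 j)) by rewrite subr_ge0 cos_le1.
have S0 : 0 <= \sum_j (1 - cos (2 * pi * (x 0 j - y 0 j))) by apply: sumr_ge0.
have [near|/existsNP[j /negP]] := pselect (forall j, `|s j| < del).
  rewrite distrC -(ph y m); apply: (@le_trans _ _ e).
    apply: hdl => j; apply: lt_le_trans deld.
    by have := near j; rewrite /s !mxE opprD addrA.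
  by rewrite lerDl mulr_ge0 // divr_ge0 ?mulr_ge0 // ltW.
rewrite -leNgt => far.
apply: (@le_trans _ _ (2 * B)).
  by apply: le_trans (ler_normB _ _) _; rewrite mulr2n mulrDl mul1r lerD.
apply: (@le_trans _ _ (2 * B / eta * \sum_j (1 - cos (2 * pi * (x 0 j - y 0 j)))));
  last by rewrite lerDr ltW.
rewrite -mulrA ler_peMr ?mulr_ge0 //.
rewrite ler_pdivlMl // mulr1 (bigD1 j) //= ler_wpDr ?sumr_ge0 //.
rewrite cs /eta lerD2l lerN2 -cos_norm normrM (gtr0_norm (_ : 0 < 2 * pi)) ?mulr_gt0 //.
have hsj : `|s j| <= 1 / 2 by rewrite ler_norml; exact: hs.
rewrite leNgt ltr_cos ?in_itv /=; last 2 first.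
- by apply/andP; split; nra.
- by have := normr_ge0 (s j) => h0; apply/andP; split; nra.
by rewrite -leNgt ler_pM2l // mulr_gt0.
Qed.

(** Integrating the bound of [periodic_modulus] against the kernel bounds the error by e / 2 + C d
    (1 - c N 1), and the second term tends to 0. *)
Theorem korovkin d (c : nat -> nat -> R) (h : 'rV[R]_d -> R) x :
  Zperiodic h -> continuous h ->
  (forall N, c N 0%N = 1) -> (forall N t, 0 <= csum N.+1 (c N) t) ->
  c N 1%N @[N --> \oo] --> (1 : R) ->
  sigma N (c N) h x @[N --> \oo] --> h x.
Proof.
move=> ph ch c0 cge c1; have bh := bmeas_periodic ph ch.
apply/cvgrPdist_le => e e0.
have e2 : 0 < e / 2 by rewrite divr_gt0.
have [C C0 hC] := periodic_modulus x ph ch e2.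
(* The summand 1 keeps the divisor positive even if C = 0. *)
have d0 : 0 < C * d%:R + 1 by rewrite ltr_wpDl // mulr_ge0.
have e3 : 0 < e / 2 / (C * d%:R + 1) by rewrite divr_gt0.
near=> N.
have N0 : (0 < N)%N by near: N; exact: nbhs_infty_gt.
have cN : `|1 - c N 1%N| <= e / 2 / (C * d%:R + 1).
  near: N; by have /cvgrPdist_le/(_ _ e3) := c1.
have K0 y : 0 <= kernel N (c N) (x - y) by apply: prodr_ge0 => j _; exact: cge.
have bK := bmeas_kernel N (c N) x.
have bS (j : 'I_d) : bmeas (fun y : 'rV[R]_d => cos (2 * pi * (x 0 j - y 0 j))).
  pose u : 'rV[int]_d := \row_i (i == j)%:Z.
  have := bmeas_cosB u x; congr bmeas; apply/funext => y; congr (cos (_ * _)).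
  rewrite /dotZ (bigD1 j) //= big1 => [|i ij]; last by rewrite mxE (negbTE ij) mul0r.
  by rewrite !mxE eqxx mul1r addr0.
have bS1 (j : 'I_d) : bmeas (fun y : 'rV[R]_d => 1 - cos (2 * pi * (x 0 j - y 0 j))).
  by apply: bmeasB => //; exact: bmeas_cst.
rewrite sigmaE // distrC.
have -> : h x = torus_int (fun y => h x * kernel N (c N) (x - y)).
  by rewrite torus_intZ // torus_int_kernel1 // mulr1.
rewrite -torus_intB; last 2 first.
- exact: bmeasM.
- by apply: bmeasM => //; exact: bmeas_cst.
have bd : bmeas (fun y => h y - h x) by apply: bmeasB => //; exact: bmeas_cst.
apply: (@le_trans _ _ (torus_int (fun y => `|h y - h x| * kernel N (c N) (x - y)))).
  rewrite ler_norml -mulN1r -torus_intZ; last by apply: bmeasM => //; exact: bmeas_norm.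
  apply/andP; split; apply: le_torus_int => [||y];
    try (do ?[apply: bmeasM|apply: bmeasB|exact: bmeas_cst|exact: bmeas_norm|by []]).
  - rewrite -mulrBl mulrA ler_wpM2r // mulN1r lerNl -normrN.
    exact: ler_norm.
  - by rewrite -mulrBl ler_wpM2r // ler_norm.
(* The bound of [periodic_modulus] times the kernel, expanded so that only the mass and the first
   moments enter its integral. *)
pose G (y : 'rV[R]_d) := e / 2 * kernel N (c N) (x - y) +
   C * \sum_j (kernel N (c N) (x - y) - cos (2 * pi * (x 0 j - y 0 j)) * kernel N (c N) (x - y)).
have bT (j : 'I_d) : bmeas (fun y : 'rV[R]_d => kernel N (c N) (x - y) -
     cos (2 * pi * (x 0 j - y 0 j)) * kernel N (c N) (x - y)).
  by apply: bmeasB => //; exact: bmeasM.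
have bG1 : bmeas (fun y : 'rV[R]_d => e / 2 * kernel N (c N) (x - y)).
  by apply: bmeasM => //; exact: bmeas_cst.
have bG2 : bmeas (fun y : 'rV[R]_d => \sum_j (kernel N (c N) (x - y) -
     cos (2 * pi * (x 0 j - y 0 j)) * kernel N (c N) (x - y))).
  exact: bmeas_sum.
have bG3 : bmeas (fun y : 'rV[R]_d => C * \sum_j (kernel N (c N) (x - y) -
     cos (2 * pi * (x 0 j - y 0 j)) * kernel N (c N) (x - y))).
  by apply: bmeasM => //; exact: bmeas_cst.
apply: (@le_trans _ _ (torus_int G)).
  apply: le_torus_int => [||y].
  - by apply: bmeasM => //; exact: bmeas_norm.
  - exact: bmeasD.
  - apply: (le_trans (ler_wpM2r (K0 y) (hC y))); rewrite /G mulrDl lerD2l -mulrA ler_wpM2l //.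
    by rewrite mulr_suml; apply: ler_sum => j _; rewrite mulrBl mul1r.
rewrite torus_intD // !torus_intZ // torus_int_kernel1 // mulr1 torus_int_sum //.
rewrite (eq_bigr (fun=> 1 - c N 1%N)); last first.
  move=> j _; rewrite torus_intB //; last exact: bmeasM.
  by rewrite torus_int_kernel1 // torus_int_kernel_cos.
rewrite sumr_const card_ord -[X in C * X]mulr_natl mulrA.
have h1 : 1 - c N 1%N <= e / 2 / (C * d%:R + 1) by apply: le_trans cN; exact: ler_norm.
have Cd : 0 <= C * d%:R by rewrite mulr_ge0.
have h2 : C * d%:R * (1 - c N 1%N) <= C * d%:R * (e / 2 / (C * d%:R + 1)) by rewrite ler_wpM2l.
have h3 : C * d%:R * (e / 2 / (C * d%:R + 1)) <= e / 2.
  rewrite mulrA ler_pdivrMr // mulrC ler_wpM2l ?ltW //; lra.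
lra.
Unshelve. all: by end_near. Qed.

Lemma kwt1_ge0 N t : 0 <= csum N.+1 (kwt (1 : R) N) t.
Proof.
have := gauss_product_cos N t (ltr01 : 0 < (1 : R)); rewrite !expr1n.
have -> : csum N.+1 (fun k => 1 ^+ (k ^ 2) * kwt 1 N k) t = csum N.+1 (kwt 1 N) t.
  by apply: eq_bigr => k _; rewrite expr1n mul1r.
have g0 : 0 < gauss (1 : R) (N + N) N by rewrite gauss_gt0 // leq_addr.
move=> h; rewrite -(pmulr_rge0 _ g0) -h; apply: prodr_ge0 => m _.
by rewrite !expr1n; have := cos_geN1 t; lra.
Qed.

Lemma korovkin_kwt d (h : 'rV[R]_d -> R) x : Zperiodic h -> continuous h ->
  sigma N (kwt 1 N) h x @[N --> \oo] --> h x.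
Proof.
move=> ph ch; apply: korovkin => //.
- by move=> N; rewrite /kwt big_ord0.
- exact: kwt1_ge0.
- by apply: cvg_kwt; rewrite ltr01 lexx.
Qed.

End Korovkin.

(** * Fourier coefficients of Gaussian, majorant and gap *)

Section Weights.
Variable R : realType.
Implicit Types (q t : R) (c : nat -> R).

Lemma csum_pair c n t : csum n.+2 (fun k => if k is 0 then c 0%N else if k == n.+1 then c n.+1 else 0) t
  = c 0%N + 2 * c n.+1 * cos (n.+1%:R * t).
Proof.
rewrite /csum big_ord_recl big_ord_recr /= big1 => [|i _].
  by rewrite /bump /= add1n eqxx mul0r cos0 add0r; ring.
by rewrite /bump /= add1n eqSS (ltn_eqF (ltn_ord i)) mulr0 mul0r.
Qed.

Lemma mser0_ge1 q a : 0 < q < 1 -> (0 < a)%N -> 1 <= mser q a 0.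
Proof.
move=> hq a0; have h := @mser_majorant R q a 1 (fun k => (k == 0%N)%:R) hq a0.
have [||_] := h _ _ 0.
- by case.
- by move=> t; rewrite /csum big_ord1 /= mul0r cos0 !mulr1.
- by rewrite /csum !big_ord1 /= expr0 !mul0r cos0 !mulr1 !mul1r.
Qed.

(** A nonnegative function has no Fourier coefficient larger than its mean: [mser_majorant] is
    tested at 0 on the kernels 1 + cos(n t) and 1 - cos(n t). *)
Lemma mser_dist q a n : 0 < q < 1 -> (0 < a)%N ->
  `|mser q a n - q ^+ (n ^ 2)| <= mser q a 0 - 1.
Proof.
move=> hq a0; case: n => [|n].
  by rewrite expr0 ger0_norm // subr_ge0 mser0_ge1.
have key (s : R) : `|s| <= 1 -> 1 + s * q ^+ (n.+1 ^ 2) <= mser q a 0 + s * mser q a n.+1.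
  move=> s1.
  pose c k : R := if k is 0 then 1 else if k == n.+1 then s / 2 else 0.
  have c0 k : (n.+2 <= k)%N -> c k = 0.
    by case: k => // k nk; rewrite /c gtn_eqF.
  have cE v t : csum n.+2 (fun k => c k * v k) t = v 0%N + s * v n.+1 * cos (n.+1%:R * t).
    have E := csum_pair (fun k => c k * v k) n t.
    have cn : c n.+1 = s / 2 by rewrite /c eqxx.
    transitivity (1 * v 0%N + 2 * (s / 2 * v n.+1) * cos (n.+1%:R * t)); last by field.
    rewrite -cn -[1]/(c 0%N) -E; apply: eq_bigr => -[[|k] hk] _ //=.
    rewrite eqSS; case: (eqVneq k n) => [->|ne] /=; first by rewrite ?eqxx.
    by rewrite /c ?eqSS /= ?(negbTE ne) ?mul0r.
  have cge t : 0 <= csum n.+2 c t.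
    have := cE (fun=> 1) t; under eq_fun do rewrite mulr1; rewrite mulr1.
    have -> : csum n.+2 (fun x => c x) t = csum n.+2 c t by [].
    move=> ->; have := ler_pM (normr_ge0 s) (normr_ge0 _) s1 (cos_max (n.+1%:R * t)).
    by rewrite -normrM mulr1 ler_norml => /andP[h _]; lra.
  have [_] := mser_majorant hq a0 c0 cge 0.
  by rewrite !cE !mulr0 cos0 !mulr1 expr0.
rewrite ler_norml; apply/andP; split.
- by have := key 1; rewrite normr1 lexx !mul1r => /(_ isT); lra.
- by have := key (- 1); rewrite normrN normr1 lexx !mulN1r => /(_ isT); lra.
Qed.

(** From A P - B P' = (A - B) P + B (P - P'), and the same identity for the dominating quantities.
    The second conclusion is carried for the induction. *)
Lemma prod_dist_le I (r : seq I) (A B A0 B0 : I -> R) :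
  (forall i, `|A i - B i| <= A0 i - B0 i) -> (forall i, `|B i| <= B0 i) ->
  `|\prod_(i <- r) A i - \prod_(i <- r) B i| <=
     \prod_(i <- r) A0 i - \prod_(i <- r) B0 i
  /\ `|\prod_(i <- r) B i| <= \prod_(i <- r) B0 i.
Proof.
move=> hA hB; elim: r => [|i r [IH1 IH2]].
  by rewrite !big_nil !subrr normr0 normr1.
rewrite !big_cons; move: IH1 IH2.
set P := \prod_(j <- r) A j; set P' := \prod_(j <- r) B j.
set P0 := \prod_(j <- r) A0 j; set P0' := \prod_(j <- r) B0 j => IH1 IH2.
have hP : `|P| <= P0.
  by rewrite -(subrK P' P) (le_trans (ler_normD _ _)) //; lra.
split; last by rewrite normrM ler_pM.
rewrite (_ : A i * P - B i * P' = (A i - B i) * P + B i * (P - P')); last by ring.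
rewrite (_ : A0 i * P0 - B0 i * P0' = (A0 i - B0 i) * P0 + B0 i * (P0 - P0')); last by ring.
by rewrite (le_trans (ler_normD _ _)) // lerD // normrM ler_pM.
Qed.

(** Jacobi's nome: at integer points [Ghat l] is [amp l] times the product of the powers
    [nome l j ^+ (k_j ^ 2)], which are the Fourier coefficients of a periodised Gaussian. *)
Definition nome d (l : 'rV[R]_d) j : R := expR (- pi / l 0 j).
Definition amp d (l : 'rV[R]_d) : R := \prod_(k < d) (l 0 k `^ (- 2^-1)).
Definition gauhat d (l : 'rV[R]_d) (k : 'rV[int]_d) : R :=
  amp l * \prod_j nome l j ^+ (absz (k 0 j) ^ 2).
Definition majhat d (a : 'I_d -> nat) (l : 'rV[R]_d) (k : 'rV[int]_d) : R :=
  amp l * \prod_j mser (nome l j) (a j) (absz (k 0 j)).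
Definition gaphat d (a : 'I_d -> nat) (l : 'rV[R]_d) k := majhat a l k - gauhat l k.

Lemma nome_itv d (l : 'rV[R]_d) j : Lambda l -> 0 < nome l j < 1.
Proof.
move=> hl; rewrite expR_gt0 /= expR_lt1 mulNr oppr_lt0 divr_gt0 ?pi_gt0 //.
Qed.

Lemma amp_gt0 d (l : 'rV[R]_d) : Lambda l -> 0 < amp l.
Proof. by move=> hl; apply: prodr_gt0 => j _; apply: powR_gt0; exact: hl. Qed.

Lemma gauhat_ge0 d (l : 'rV[R]_d) k : Lambda l -> 0 <= gauhat l k.
Proof.
move=> hl; rewrite mulr_ge0 ?(ltW (amp_gt0 hl)) // prodr_ge0 // => j _.
by rewrite exprn_ge0 // expR_ge0.
Qed.

Lemma GhatE d (l : 'rV[R]_d) (k : 'rV[int]_d) : Ghat l (map_mx intr k) = gauhat l k.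
Proof.
rewrite /Ghat big_split /=; congr (_ * _); apply: eq_bigr => j _.
rewrite mxE /nome -expRM_natl; congr expR.
have -> : ((absz (k 0%R j) ^ 2)%N)%:R = ((k 0 j)%:~R : R) ^+ 2.
  by rewrite natrX natr_absz intr_norm real_normK ?num_real // .
by ring.
Qed.

(** Pairing n with -n turns the symmetric partial sums into those of the series in [mser]. The theta
    value is thus the mean of the majorant in one variable. *)
Lemma ThetaE (s : R) a : 0 < s -> (0 < a)%N ->
  Theta 0 ('i * (a%:R ^+ 2 / s)%:C) = (mser (expR (- pi / s)) a 0)%:C.
Proof.
move=> s0 a0; set q := expR _.
have hq : 0 < q < 1.
  by rewrite expR_gt0 /= expR_lt1 mulNr oppr_lt0 divr_gt0 ?pi_gt0.
have q0 : 0 <= q by case/andP: hq => /ltW.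
have term (n : int) : cexp (2 * pi%:C * 'i * n%:~R * 0) *
   cexp (pi%:C * 'i * ('i * (a%:R ^+ 2 / s)%:C) * n%:~R ^+ 2) =
   (q ^+ ((absz n * a) ^ 2))%:C.
  rewrite mulr0.
  have -> : cexp (0 : R[i]) = 1 by rewrite /cexp /= expR0 cos0 sin0 mul1r.
  have -> : pi%:C * 'i * ('i * (a%:R ^+ 2 / s)%:C) * n%:~R ^+ 2 =
            (((absz n * a) ^ 2)%:R * (- pi / s))%:C :> R[i].
    have -> : (n%:~R : R[i]) ^+ 2 = ((n%:~R : R) ^+ 2)%:C.
      by rewrite rmorphXn rmorph_int.
    have -> : ((absz n * a) ^ 2)%:R = (n%:~R : R) ^+ 2 * a%:R ^+ 2.
      by rewrite natrX natrM exprMn natr_absz intr_norm real_normK ?num_real.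
    have key (p x u : R) : p%:C * 'i * ('i * u%:C) * (x ^+ 2)%:C = (- (p * u * x ^+ 2))%:C.
      by apply: eqcP; rewrite /=; ring.
    by rewrite key; congr (_%:C); ring.
  rewrite mul1r /cexp /= cos0 sin0 expRM_natl -/q.
  by apply: eqcP; rewrite /=; ring.
rewrite /Theta.
have -> : (fun N => \sum_(k < N.*2.+1)
    let n : int := k%:Z - N%:Z in
    cexp (2 * pi%:C * 'i * n%:~R * 0) *
    cexp (pi%:C * 'i * ('i * (a%:R ^+ 2 / s)%:C) * n%:~R ^+ 2)) =
  (fun N => (csum N.+1 (fun k => q ^+ ((k * a) ^ 2)) 0)%:C).
  apply/funext => N /=; rewrite -csum_cis -addnn; apply: eq_bigr => k _.
  by rewrite term mulr0 cis0 mulr1.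
have cE N : csum N.+1 (fun k => q ^+ ((k * a) ^ 2)) 0 =
   1 + 2 * series (fun l => q ^+ ((l.+1 * a) ^ 2)) N.
  rewrite /csum big_ord_recl /= mul0n expr0 mul0r cos0 !mulr1; congr (_ + _).
  rewrite seriesEord mulr_sumr; apply: eq_bigr => l _.
  by rewrite /bump /= add1n mulr0 cos0 mulr1.
rewrite /clim; apply: eqcP => /=.
  under eq_fun do rewrite cE.
  apply/cvg_lim => //; apply: cvgD; first exact: cvg_cst.
  apply: cvgM; first exact: cvg_cst.
  have := @is_cvg_gauss_series_le R q a a (fun=> 1) hq a0.
  under eq_fun do rewrite mul1r addnC -mulSn.
  by apply=> l; rewrite ler01 ler1n.
by rewrite lim_cst.
Qed.

Lemma theta_weightE d (a : 'I_d -> nat) (l : 'rV[R]_d) :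
  (forall j, (0 < a j)%N) -> Lambda l -> theta_weight a l = gaphat a l 0.
Proof.
move=> ha hl; rewrite /theta_weight /gaphat /majhat /gauhat -/(amp l).
rewrite [X in _ - X * _]/amp -/(amp l).
have -> : \prod_(j < d) Theta 0 ('i * ((a j)%:R ^+ 2 / l 0 j)%:C) =
   (\prod_j mser (nome l j) (a j) 0)%:C.
  rewrite rmorph_prod; apply: eq_bigr => j _; apply: ThetaE => //; exact: hl.
rewrite /= [X in _ = _ - _ * X]big1 => [|j _]; last by rewrite mxE expr0.
by rewrite mulr1 mulrBr mulr1; congr (_ * _ - _); apply: eq_bigr => j _; rewrite mxE.
Qed.

(** Supplies the [nu]-integrability of every gap coefficient from that of the zeroth one, the theta
    weight. *)
Lemma gaphat_dist d (a : 'I_d -> nat) (l : 'rV[R]_d) k :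
  (forall j, (0 < a j)%N) -> Lambda l -> `|gaphat a l k| <= gaphat a l 0.
Proof.
move=> ha hl; rewrite /gaphat /majhat /gauhat -!mulrBr normrM.
have a0 := amp_gt0 hl; rewrite (gtr0_norm a0) ler_pM2l //.
apply: (proj1 (prod_dist_le _ _ _)) => j; rewrite mxE expr0.
  by apply: mser_dist => //; exact: nome_itv.
have /andP[q0 q1] := nome_itv j hl.
by rewrite ger0_norm ?exprn_ge0 ?exprn_ile1 ?ltW.
Qed.

Lemma gaphat_outside d (a : 'I_d -> nat) (l : 'rV[R]_d) (k : 'rV[int]_d) j :
  (0 < a j)%N -> (a j <= absz (k 0%R j))%N -> gaphat a l k = - gauhat l k.
Proof.
move=> a0 ak; rewrite /gaphat /majhat (bigD1 j) //=.
have -> : mser (nome l j) (a j) (absz (k 0 j)) = 0.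
  by move: ak; rewrite /mser; case: (absz _) => [|r]; [case: (a j) a0|rewrite ltnNge => ->].
by rewrite mul0r mulr0 sub0r.
Qed.

(** Kernel, Gaussian and majorant all factor over the coordinates, so the sum is a difference of two
    products, compared factor by factor with both halves of [mser_majorant]. *)
Lemma gaphat_kernel_ge0 d (a : 'I_d -> nat) (l : 'rV[R]_d) N (x : 'rV[R]_d) :
  (forall j, (0 < a j)%N) -> Lambda l ->
  0 <= \sum_(f : {ffun 'I_d -> 'I_(N + N).+1})
    (\prod_j kwt 1 N (absz (freq f 0 j))) * cos (2 * pi * dotZ (freq f) x) *
    gaphat a l (freq f).
Proof.
move=> ha hl.
have -> : \sum_(f : {ffun 'I_d -> 'I_(N + N).+1})
    (\prod_j kwt 1 N (absz (freq f 0 j))) * cos (2 * pi * dotZ (freq f) x) *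
    gaphat a l (freq f) =
  amp l * (\prod_j csum N.+1 (fun k => kwt 1 N k * mser (nome l j) (a j) k) (2 * pi * x 0 j) -
           \prod_j csum N.+1 (fun k => kwt 1 N k * nome l j ^+ (k ^ 2)) (2 * pi * x 0 j)).
  rewrite (prod_csum N (fun j k => kwt 1 N k * mser (nome l j) (a j) k)).
  rewrite (prod_csum N (fun j k => kwt 1 N k * nome l j ^+ (k ^ 2))).
  rewrite -sumrB mulr_sumr; apply: eq_bigr => f _.
  by rewrite !big_split /= /gaphat /majhat /gauhat; ring.
apply: mulr_ge0; first exact/ltW/amp_gt0.
rewrite subr_ge0; apply: ler_prod => j _; apply/andP.
apply: mser_majorant => //; first exact: nome_itv.
- by move=> k; exact: kwt_small.
- exact: kwt1_ge0.
Qed.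

(** These are the frequencies that sampling on the lattice cannot tell from 0. *)
Definition aliased d (a : 'I_d -> nat) (k : 'rV[int]_d) : bool :=
  [forall j, (a j %| absz (k 0%R j))%N].

(* The frequencies, other than [0], that the lattice mean of the [N]-th kernel
   mean of a function does not annihilate. *)
Definition psi d (a : 'I_d -> nat) N (l : 'rV[R]_d) : R :=
  \sum_(f : {ffun 'I_d -> 'I_(N + N).+1} | aliased a (freq f) && (freq f != 0))
    (\prod_j kwt 1 N (absz (freq f 0 j))) * gauhat l (freq f).

Lemma csum_dvd N a (w : nat -> R) : (0 < a)%N -> (forall k, (N < k)%N -> w k = 0) ->
  csum N.+1 (fun k => (a %| k)%:R * w k) 0 = mcoef w a N.+1 0.
Proof.
move=> a0 w0; have h : (N.+1 <= N.+1 * a)%N by rewrite leq_pmulr.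
rewrite -(csum_widen 0 h); last by move=> k nk; rewrite w0 // mulr0.
rewrite /csum (sum_ord_mul (fun k => eps R k * ((a %| k)%:R * w k) * cos (k%:R * 0))).
apply: eq_bigr => l _; case: a a0 h => // A _ _.
rewrite big_ord_recl /= addn0 dvdn_mull // mul1r mulr0 cos0 mulr1 big1 ?addr0 => [|r _].
  by case: (nat_of_ord l) => // k; rewrite mulSn.
rewrite /bump /= add1n dvdn_addr ?dvdn_mull // gtnNdvd ?ltnS //.
by rewrite mul0r mulr0 mul0r.
Qed.

(** The aliasing condition is a condition on each coordinate, so the sum over all aliased
    frequencies is a product; subtracting 1 removes the frequency 0. *)
Lemma psiE d (a : 'I_d -> nat) N (l : 'rV[R]_d) : (forall j, (0 < a j)%N) ->
  psi a N l = amp l *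
    (\prod_j mcoef (fun k => nome l j ^+ (k ^ 2) * kwt 1 N k) (a j) N.+1 0 - 1).
Proof.
move=> ha.
have E : \prod_j mcoef (fun k => nome l j ^+ (k ^ 2) * kwt 1 N k) (a j) N.+1 0 =
  \sum_(f : {ffun 'I_d -> 'I_(N + N).+1} | aliased a (freq f))
    (\prod_j kwt 1 N (absz (freq f 0 j))) * \prod_j nome l j ^+ (absz (freq f 0 j) ^ 2).
  transitivity (\prod_j csum N.+1 (fun k => (a j %| k)%:R * (nome l j ^+ (k ^ 2) * kwt 1 N k))
      (2 * pi * (0 : 'rV[R]_d) 0 j)).
    apply: eq_bigr => j _; rewrite mxE mulr0 csum_dvd // => k Nk.
    by rewrite kwt_small // mulr0.
  rewrite (prod_csum N (fun j k => (a j %| k)%:R * (nome l j ^+ (k ^ 2) * kwt 1 N k))).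
  rewrite [RHS]big_mkcond; apply: eq_bigr => f _.
  have -> : dotZ (freq f) (0 : 'rV[R]_d) = 0.
    by rewrite /dotZ big1 // => j _; rewrite [X in _ * X]mxE mulr0.
  rewrite mulr0 cos0 mulr1 big_split /=.
  case: ifPn => [/forallP hf|/forallPn[j hj]].
    rewrite big1 ?mul1r => [|j _]; last by rewrite hf.
    by rewrite big_split /= mulrC.
  by rewrite (bigD1 j) //= (negbTE hj) !mul0r.
have [f0 f0E] : exists f, freq (d := d) (N := N) f = 0.
  by apply: freqP => j; rewrite mxE.
rewrite E (bigD1 f0) /=; last by apply/forallP => j; rewrite f0E mxE dvdn0.
rewrite f0E big1 ?mul1r => [|j _]; last by rewrite mxE /kwt big_ord0.
rewrite big1 => [|j _]; last by rewrite mxE expr0.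
rewrite addrC addrK mulr_sumr /psi; apply: eq_big => [f|f _].
  by rewrite -f0E (inj_eq (@freq_inj d N)).
by rewrite /gauhat; ring.
Qed.

Lemma cvg_psi d (a : 'I_d -> nat) (l : 'rV[R]_d) :
  (forall j, (0 < a j)%N) -> Lambda l ->
  psi a N l @[N --> \oo] --> gaphat a l 0.
Proof.
move=> ha hl.
have -> : gaphat a l 0 = amp l * (\prod_j mser (nome l j) (a j) 0 - 1).
  rewrite /gaphat /majhat /gauhat mulrBr; congr (_ * _ - _ * _).
    by apply: eq_bigr => j _; rewrite mxE.
  by rewrite big1 // => j _; rewrite mxE expr0.
under eq_fun do rewrite psiE //.
apply: cvgM; first exact: cvg_cst.
apply: cvgB; last exact: cvg_cst.
apply: cvg_big => [x|j _]; first exact: mul_continuous.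
by apply: cvg_mcoef_kwt => //; [exact: nome_itv|rewrite ltr01 lexx].
Qed.

Lemma psi_ge0 d (a : 'I_d -> nat) N (l : 'rV[R]_d) : Lambda l -> 0 <= psi a N l.
Proof.
move=> hl; apply: sumr_ge0 => f _; rewrite mulr_ge0 ?gauhat_ge0 //.
by apply: prodr_ge0 => j _; apply: kwt_ge0.
Qed.

(** * Measurability in the Gaussian parameter *)

Lemma measurable_coord d (j : 'I_d) : measurable_fun setT (fun l : borel R d => (l : 'rV[R]_d) 0 j).
Proof.
apply: (measurability _ (RGenOInfty.measurableE R)).
move=> _ [_ [x ->] <-]; rewrite setTI; apply: sub_sigma_algebra.
have /continuousP := (@coord_continuous R 1 d 0 j); apply.
rewrite (_ : `]x, +oo[%classic = [set y | x < y]); first exact: open_gt.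
by rewrite set_itvE.
Qed.

Lemma measurable_Lambda d : measurable (@Lambda R d : set (borel R d)).
Proof.
have -> : (@Lambda R d : set (borel R d)) = \bigcap_(j in [set: 'I_d])
    ((fun l : borel R d => (l : 'rV[R]_d) 0 j) @^-1` `]0, +oo[%classic).
  apply/seteqP; split=> [l hl j _|l hl j]; rewrite /= ?in_itv /= ?andbT; first exact: hl.
  by have := hl j I; rewrite /= in_itv /= andbT.
apply: fin_bigcap_measurable => // j _; rewrite -[X in measurable X]setTI.
exact: measurable_coord.
Qed.

Lemma measurable_nome d (j : 'I_d) :
  measurable_fun (@Lambda R d : set (borel R d)) (fun l => nome (l : 'rV[R]_d) j).
Proof.
have := measurable_funTS (D := @Lambda R d : set (borel R d)) (@measurable_coord d j) => mj.
apply: (@eq_measurable_fun _ _ _ _ _ (fun l : borel R d => expR (- pi * ((l : 'rV[R]_d) 0 j `^ (-1))))).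
  by move=> l; rewrite inE => hl; rewrite /nome powR_inv1 // ltW //; exact: hl.
apply: measurableT_comp => //; apply: measurable_funM; first exact: measurable_cst.
exact: (@measurableT_comp _ _ _ _ _ _ (fun y : R => y `^ (-1)) _ (fun l : borel R d => (l : 'rV[R]_d) 0 j)).
Qed.

Lemma measurable_amp d : measurable_fun (@Lambda R d : set (borel R d)) (fun l => amp (l : 'rV[R]_d)).
Proof.
apply: measurable_prod => j _.
apply: (@measurableT_comp _ _ _ _ _ _ (fun y : R => y `^ (- 2^-1)) _ (fun l : borel R d => (l : 'rV[R]_d) 0 j)) => //.
exact: measurable_funTS (measurable_coord j).
Qed.

Lemma measurable_gauhat d k :
  measurable_fun (@Lambda R d : set (borel R d)) (fun l => gauhat (l : 'rV[R]_d) k).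
Proof.
apply: measurable_funM; first exact: measurable_amp.
by apply: measurable_prod => j _; apply: measurable_funX; exact: measurable_nome.
Qed.

(** The series is a pointwise limit of the finite sums [mcoef], which are polynomials in the
    nome. *)
Lemma measurable_mser d (j : 'I_d) a r : (0 < a)%N ->
  measurable_fun (@Lambda R d : set (borel R d)) (fun l => mser (nome (l : 'rV[R]_d) j) a r).
Proof.
move=> a0.
apply: (@measurable_fun_cvg _ _ _ _ (fun N (l : borel R d) => mcoef (fun k => nome (l : 'rV[R]_d) j ^+ (k ^ 2) * kwt 1 N k) a N.+1 r)).
  move=> N; have mw k : measurable_fun (@Lambda R d : set (borel R d))
      (fun l => nome (l : 'rV[R]_d) j ^+ (k ^ 2) * kwt 1 N k).
    apply: measurable_funM; last exact: measurable_cst.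
    apply: measurable_funX; exact: measurable_nome.
  case: r => [|r]; rewrite /mcoef.
    apply: measurable_sum => l; apply: measurable_funM; [exact: measurable_cst|exact: mw].
  case: (r.+1 < a)%N; last exact: measurable_cst.
  apply: measurable_sum => l; apply: measurable_funB;
    by apply: measurable_funM; [exact: measurable_cst|exact: mw].
move=> l hl; apply: cvg_mcoef_kwt => //; last by rewrite ltr01 lexx.
exact: nome_itv.
Qed.

Lemma measurable_gaphat d (a : 'I_d -> nat) k : (forall j, (0 < a j)%N) ->
  measurable_fun (@Lambda R d : set (borel R d)) (fun l => gaphat a (l : 'rV[R]_d) k).
Proof.
move=> ha; apply: measurable_funB; last exact: measurable_gauhat.
apply: measurable_funM; first exact: measurable_amp.
by apply: measurable_prod => j _; exact: measurable_mser.
Qed.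

End Weights.

(** * Real trigonometric polynomials and sampling on the lattice *)

Section TrigPoly.
Variable R : realType.

(** The real part of the sum of (A n + i B n) e^{2 pi i n . x} over r. *)
Definition trig d (r : seq 'rV[int]_d) (A B : 'rV[int]_d -> R) (x : 'rV[R]_d) : R :=
  \sum_(n <- r) (A n * cos (2 * pi * dotZ n x) - B n * sin (2 * pi * dotZ n x)).

Lemma sinE (t : R) : sin t = - cos (t + pi / 2).
Proof. by rewrite cosDpihalf opprK. Qed.

Lemma sinE' (t : R) : sin t = cos (- (pi / 2) + t).
Proof. by rewrite addrC cosBpihalf. Qed.

Lemma dotZDr d (n : 'rV[int]_d) (x y : 'rV[R]_d) : dotZ n (x + y) = dotZ n x + dotZ n y.
Proof. by rewrite /dotZ -big_split; apply: eq_bigr => j _; rewrite !mxE mulrDr. Qed.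

Lemma dotZ_int d (n m : 'rV[int]_d) :
  dotZ n (map_mx intr m : 'rV[R]_d) = (\sum_j n 0 j * m 0 j)%:~R.
Proof. by rewrite /dotZ rmorph_sum; apply: eq_bigr => j _; rewrite mxE rmorphM. Qed.

Lemma trig_periodic d (r : seq 'rV[int]_d) A B : Zperiodic (trig r A B).
Proof.
move=> x m; apply: eq_bigr => n _.
have -> : 2 * pi * dotZ n (x + map_mx intr m) =
   2 * pi * dotZ n x + (\sum_j n 0 j * m 0 j)%:~R * (2 * pi).
  by rewrite dotZDr dotZ_int; ring.
by rewrite cos_periodz !sinE addrAC cos_periodz.
Qed.

Lemma continuous_sum (T : topologicalType) I (r : seq I) (F : I -> T -> R) :
  (forall i, continuous (F i)) -> continuous (fun x => \sum_(i <- r) F i x).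
Proof.
move=> h; elim: r => [|i r IH] x.
  by under eq_fun do rewrite big_nil; exact: cst_continuous.
by under eq_fun do rewrite big_cons; apply: continuousD; [exact: h|exact: IH].
Qed.

Lemma continuous_dotZ d (n : 'rV[int]_d) : continuous (fun x : 'rV[R]_d => dotZ n x).
Proof.
apply: continuous_sum => j x.
by apply: continuousM; [exact: cst_continuous|exact: coord_continuous].
Qed.

Lemma trig_continuous d (r : seq 'rV[int]_d) A B : continuous (trig r A B).
Proof.
apply: continuous_sum => n x.
have cl : continuous (fun y : 'rV[R]_d => 2 * pi * dotZ n y).
  have cm : continuous (fun z : R => 2 * pi * z).
    by move=> z; apply: (@continuousM _ _ (fun=> 2 * pi) (fun z : R => z)); [exact: cst_continuous|exact: cvg_id].
  by move=> y; apply: (@continuous_comp _ _ _ (fun y => dotZ n y)); [exact: continuous_dotZ|exact: cm].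
apply: (@continuousB _ _ _ (fun y : 'rV[R]_d => A n * cos (2 * pi * dotZ n y))
   (fun y : 'rV[R]_d => B n * sin (2 * pi * dotZ n y))).
  apply: (@continuousM _ _ (fun=> A n) (fun y : 'rV[R]_d => cos (2 * pi * dotZ n y))); first exact: cst_continuous.
  by apply: (@continuous_comp _ _ _ (fun y => 2 * pi * dotZ n y)); [exact: cl|exact: continuous_cos].
apply: (@continuousM _ _ (fun=> B n) (fun y : 'rV[R]_d => sin (2 * pi * dotZ n y))); first exact: cst_continuous.
by apply: (@continuous_comp _ _ _ (fun y => 2 * pi * dotZ n y)); [exact: cl|exact: continuous_sin].
Qed.

Lemma bmeas_trig d (r : seq 'rV[int]_d) A B : bmeas (trig r A B).
Proof. by apply: bmeas_periodic; [exact: trig_periodic|exact: trig_continuous]. Qed.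

Lemma torus_int_coscos d (c1 c2 : R) (m n : 'rV[int]_d) :
  torus_int (fun x => cos (c1 + 2 * pi * dotZ m x) * cos (c2 + 2 * pi * dotZ n x)) =
  ((m == n)%:R * cos (c1 - c2) + (m == - n)%:R * cos (c1 + c2)) / 2.
Proof.
transitivity (torus_int (fun x : 'rV[R]_d => 2^-1 * (cos ((c1 - c2) + 2 * pi * dotZ (m - n) x) +
    cos ((c1 + c2) + 2 * pi * dotZ (m + n) x)))).
  congr torus_int; apply/funext => x; rewrite !dotZDl dotZNl.
  have -> : c1 - c2 + 2 * pi * (dotZ m x - dotZ n x) =
     (c1 + 2 * pi * dotZ m x) - (c2 + 2 * pi * dotZ n x) by ring.
  have -> : c1 + c2 + 2 * pi * (dotZ m x + dotZ n x) =
     (c1 + 2 * pi * dotZ m x) + (c2 + 2 * pi * dotZ n x) by ring.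
  move: (c1 + 2 * pi * dotZ m x) (c2 + 2 * pi * dotZ n x) => u v.
  by rewrite cosB cosD; field.
rewrite torus_intZ; last by apply: bmeasD; exact: bmeas_cos.
rewrite torus_intD; [|exact: bmeas_cos|exact: bmeas_cos].
rewrite !torus_int_cos subr_eq0 addr_eq0 mulrC.
by case: (m == n); case: (m == - n); rewrite ?mul1r ?mul0r.
Qed.

Lemma sum_pick d (r : seq 'rV[int]_d) (F : 'rV[int]_d -> R) n : uniq r ->
  \sum_(m <- r) (m == n)%:R * F m = (n \in r)%:R * F n.
Proof.
move=> ur; case: (boolP (n \in r)) => nr.
  rewrite (bigD1_seq n) //= eqxx big1 ?addr0 // => m mn.
  by rewrite (negbTE mn) mul0r.
rewrite mul0r big_seq big1 // => m mr; case: eqP => [mn|]; last by rewrite mul0r.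
by rewrite -mn mr in nr.
Qed.

(** The phase c = 0 yields the real part of a Fourier coefficient; c = - pi / 2 turns the cosine
    into the sine of the imaginary part. Both n and -n respond, hence two summands. *)
Lemma torus_int_trig d (r : seq 'rV[int]_d) A B (c : R) n : uniq r ->
  torus_int (fun x => trig r A B x * cos (c + 2 * pi * dotZ n x)) =
  ((n \in r)%:R * (A n * cos c + B n * sin c) +
   (- n \in r)%:R * (A (- n) * cos c - B (- n) * sin c)) / 2.
Proof.
move=> ur; rewrite /trig.
under eq_fun do rewrite mulr_suml.
have bc m c' : bmeas (fun x : 'rV[R]_d => cos (c' + 2 * pi * dotZ m x) * cos (c + 2 * pi * dotZ n x)).
  by apply: bmeasM; exact: bmeas_cos.
have bA m k c' : bmeas (fun x : 'rV[R]_d => k * (cos (c' + 2 * pi * dotZ m x) * cos (c + 2 * pi * dotZ n x))).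
  by apply: bmeasM => //; exact: bmeas_cst.
have E (x : 'rV[R]_d) m : (A m * cos (2 * pi * dotZ m x) - B m * sin (2 * pi * dotZ m x)) *
     cos (c + 2 * pi * dotZ n x) =
   A m * (cos (0 + 2 * pi * dotZ m x) * cos (c + 2 * pi * dotZ n x)) -
   B m * (cos (- (pi / 2) + 2 * pi * dotZ m x) * cos (c + 2 * pi * dotZ n x)).
  by rewrite sinE' add0r; ring.
under eq_fun do under eq_bigr do rewrite E.
rewrite torus_int_sum; last by move=> m; exact: bmeasB.
transitivity (\sum_(m <- r) ((m == n)%:R * ((A m * cos c + B m * sin c) / 2) +
    (m == - n)%:R * ((A m * cos c - B m * sin c) / 2))).
  apply: eq_bigr => m _; rewrite torus_intB // !torus_intZ // !torus_int_coscos.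
  have e1 : cos (- (pi / 2) - c) = - sin c by rewrite -opprD cosN addrC cosDpihalf.
  by rewrite e1 -sinE' sub0r add0r cosN; field.
by rewrite big_split /= !sum_pick //; field.
Qed.

Lemma fourier_trig d (r : seq 'rV[int]_d) A B n : uniq r ->
  (forall m, (- m \in r) = (m \in r)) -> (forall m, A (- m) = A m) ->
  (forall m, B (- m) = - B m) ->
  fourier (trig r A B) n = (n \in r)%:R *: (A n +i* B n).
Proof.
move=> ur rN AN BN; apply: eqcP.
  rewrite Re_fourier; have := torus_int_trig A B 0 n ur.
  under eq_fun do rewrite add0r.
  by move=> ->; rewrite rN AN cos0 sin0 /=; case: (n \in r); rewrite /=; field.
rewrite Im_fourier; last exact: bmeas_trig.
have := torus_int_trig A B (- (pi / 2)) n ur.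
under eq_fun do rewrite -sinE'.
move=> ->; rewrite rN AN BN cosN cos_pihalf sinN sin_pihalf /=.
by case: (n \in r); rewrite /=; field.
Qed.

(** The sum of the a_j serves as a crude common bound: the box is filtered out of a cube of that
    size. *)
Definition box_seq d (a : 'I_d -> nat) : seq 'rV[int]_d :=
  [seq n : 'rV[int]_d <- [seq freq f | f <- enum {ffun 'I_d -> 'I_((\sum_j a j) + \sum_j a j).+1}] |
    [forall j, (absz (n 0%R j) < a j)%N]].

Lemma mem_box_seq d (a : 'I_d -> nat) n :
  (n \in box_seq a) = [forall j, (absz (n 0%R j) < a j)%N].
Proof.
rewrite mem_filter; case: forallP => //= h; apply/mapP.
have [|f fE] := @freqP d (\sum_j a j) n; last by exists f; rewrite ?mem_enum.
by move=> j; rewrite (leq_trans (ltnW (h j))) // (bigD1 j) //= leq_addr.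
Qed.

Lemma uniq_box_seq d (a : 'I_d -> nat) : uniq (box_seq a).
Proof. by rewrite filter_uniq // map_inj_uniq ?enum_uniq //; exact: freq_inj. Qed.

Lemma box_seqN d (a : 'I_d -> nat) n : (- n \in box_seq a) = (n \in box_seq a).
Proof. by rewrite !mem_box_seq; apply: eq_forallb => j; rewrite mxE abszN. Qed.

Lemma box_seqE d (a : 'I_d -> nat) : box a = [set` box_seq a].
Proof.
apply/seteqP; split=> n /=; rewrite mem_box_seq.
  by move=> h; apply/forallP => j; have := h j; rewrite -ltz_nat abszE.
by move=> /forallP h j; have := h j; rewrite -ltz_nat abszE.
Qed.

Lemma trigpoly_ltE d (a : 'I_d -> nat) (P : 'rV[R]_d -> R) :
  trigpoly_lt a P <-> forall x, (P x)%:C =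
    \sum_(n <- box_seq a) fourier P n * cis (2 * pi * dotZ n x).
Proof.
split=> h x; rewrite h box_seqE -fsbig_seq ?uniq_box_seq //.
  by apply: eq_bigr => n _; rewrite cexp_im.
by apply: eq_bigr => n _; rewrite cexp_im.
Qed.

Lemma trigpoly_lt_trig d (a : 'I_d -> nat) (P : 'rV[R]_d -> R) : trigpoly_lt a P ->
  P = trig (box_seq a) (fun n => complex.Re (fourier P n)) (fun n => complex.Im (fourier P n)).
Proof.
move=> /trigpoly_ltE h; apply/funext => x.
have := congr1 (@complex.Re R) (h x); rewrite Re_sum [LHS]/= => ->.
by apply: eq_bigr => n _; case: (fourier P n).
Qed.

Lemma trig_trigpoly_lt d (a : 'I_d -> nat) A B :
  (forall m, A (- m) = A m) -> (forall m, B (- m) = - B m) ->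
  trigpoly_lt a (trig (box_seq a) A B).
Proof.
move=> AN BN; apply/trigpoly_ltE => x.
transitivity (\sum_(n <- box_seq a) (A n +i* B n) * cis (2 * pi * dotZ n x)); last first.
  rewrite big_seq [RHS]big_seq; apply: eq_bigr => n nr.
  by rewrite fourier_trig ?uniq_box_seq //; [rewrite nr scale1r|exact: box_seqN].
apply: eqcP; first by rewrite Re_sum.
rewrite Im_sum /=; apply/esym.
pose T n := A n * sin (2 * pi * dotZ n x) + B n * cos (2 * pi * dotZ n x).
(* [T] collects the imaginary parts and is odd, while the box is symmetric under n -> -n. *)
suff : \sum_(n <- box_seq a) T n = - \sum_(n <- box_seq a) T n.
  by move=> h; have h2 : \sum_(n <- box_seq a) T n = 0; [lra|rewrite -[RHS]h2; apply: eq_bigr].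
have pe : perm_eq (box_seq a) [seq - n | n <- box_seq a].
  have oi : injective (fun n : 'rV[int]_d => - n) by exact: oppr_inj.
  apply: uniq_perm; rewrite ?(map_inj_uniq oi) ?uniq_box_seq //.
  by move=> n; rewrite -[n in RHS]opprK (mem_map oi) box_seqN.
rewrite {1}(perm_big _ pe) big_map -sumrN /=; apply: eq_bigr => n _.
by rewrite /T AN BN dotZNl mulrN sinN cosN; ring.
Qed.

Lemma dvdn_lt_eq0 m n : (n %| m)%N -> (m < n)%N -> m = 0%N.
Proof. by case: m => // m + mn; rewrite gtnNdvd. Qed.

(** Every coordinate runs over the same range M, later a common multiple of the a_j, so that a
    single function type indexes the samples; modulo periods each lattice point is repeated equally
    often. *)
Definition node d (a : 'I_d -> nat) M (s : {ffun 'I_d -> 'I_M}) : 'rV[R]_d :=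
  \row_j ((s j)%:R / (a j)%:R).

Lemma sum_cis_roots M a (n : int) : (0 < M)%N -> (0 < a)%N -> (a %| M)%N ->
  \sum_(s < M) cis (2 * pi * (n%:~R * (s%:R / a%:R))) =
  if (a%:Z %| n)%Z then M%:R else 0 :> R[i].
Proof.
move=> M0 a0 /dvdnP[b Mb].
have b0 : (0 < b)%N by case: b Mb M0 => // ->.
have aR : a%:R != 0 :> R by rewrite pnatr_eq0 -lt0n.
have bR : b%:R != 0 :> R by rewrite pnatr_eq0 -lt0n.
have key y : \sum_(s < M) cos (y + 2 * pi * (n%:~R * (s%:R / a%:R))) =
    if (a%:Z %| n)%Z then M%:R * cos y else 0 :> R.
  have -> : (a%:Z %| n)%Z = (M%:Z %| n * b%:Z)%Z.
    by rewrite Mb PoszM (mulrC n) !dvdzE !abszM !absz_nat dvdn_pmul2l.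
  rewrite -sum_cos_roots //; apply: eq_bigr => s _; congr (cos (_ + _)).
  have -> : M%:R = b%:R * a%:R :> R by rewrite Mb natrM.
  by rewrite intrM -pmulrn; field; rewrite aR bR.
apply: eqcP.
  rewrite Re_sum (eq_bigr (fun s : 'I_M => cos (0 + 2 * pi * (n%:~R * (s%:R / a%:R))))); last first.
    by move=> s _; rewrite add0r.
  rewrite key cos0 mulr1; case: ifP => // _.
  by rewrite -(rmorph_nat (real_complex R)).
rewrite Im_sum (eq_bigr (fun s : 'I_M => cos (- (pi / 2) + 2 * pi * (n%:~R * (s%:R / a%:R))))); last first.
  by move=> s _; rewrite -sinE'.
rewrite key cosN cos_pihalf mulr0; case: ifP => // _.
by rewrite -(rmorph_nat (real_complex R)).
Qed.

Lemma sum_node_cis d (a : 'I_d -> nat) M (n : 'rV[int]_d) : (0 < M)%N ->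
  (forall j, (0 < a j)%N) -> (forall j, (a j %| M)%N) ->
  \sum_(s : {ffun 'I_d -> 'I_M}) cis (2 * pi * dotZ n (node a s)) =
  if [forall j, (a j %| absz (n 0%R j))%N] then (M ^ d)%:R else 0.
Proof.
move=> M0 a0 aM.
have -> : \sum_(s : {ffun 'I_d -> 'I_M}) cis (2 * pi * dotZ n (node a s)) =
   \prod_j \sum_(s < M) cis (2 * pi * ((n 0 j)%:~R * (s%:R / (a j)%:R))).
  rewrite bigA_distr_bigA /=; apply: eq_bigr => s _.
  rewrite /dotZ mulr_sumr cis_sum; apply: eq_bigr => j _; by rewrite mxE.
rewrite (eq_bigr (fun j => if ((a j)%:Z %| n 0%R j)%Z then M%:R else 0 : R[i])); last first.
  by move=> j _; exact: sum_cis_roots.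
case: forallP => [h|/forallP/forallPn[j hj]].
  rewrite (eq_bigr (fun=> M%:R)) ?prodr_const ?card_ord ?natrX // => j _.
  by rewrite dvdzE /= h.
by rewrite (bigD1 j) //= dvdzE /= (negbTE hj) mul0r.
Qed.

Definition node_mean d (a : 'I_d -> nat) M (f : 'rV[R]_d -> R) : R :=
  (M ^ d)%:R^-1 * \sum_(s : {ffun 'I_d -> 'I_M}) f (node a s).

Lemma node_mean_trig d (a : 'I_d -> nat) M (r : seq 'rV[int]_d) A B : (0 < M)%N ->
  (forall j, (0 < a j)%N) -> (forall j, (a j %| M)%N) ->
  node_mean a M (trig r A B) =
  \sum_(n <- r | [forall j, (a j %| absz (n 0%R j))%N]) A n.
Proof.
move=> M0 a0 aM; have MR : (M ^ d)%:R != 0 :> R by rewrite pnatr_eq0 expn_eq0 negb_and -lt0n M0.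
rewrite /node_mean /trig exchange_big /= mulr_sumr [RHS]big_mkcond.
apply: eq_bigr => n _; rewrite sumrB -!mulr_sumr.
have h := sum_node_cis n M0 a0 aM.
have hRe := congr1 (@complex.Re R) h; have hIm := congr1 (@complex.Im R) h.
rewrite Re_sum /= in hRe; rewrite Im_sum /= in hIm.
rewrite hRe hIm; case: ifP => _ /=; last by rewrite !mulr0 subr0 mulr0.
by rewrite -(rmorph_nat (real_complex R)) /= mulr0 subr0 mulrCA mulVf // mulr1.
Qed.

(** The only frequency of the box that is divisible by a_j in every coordinate is 0, so the lattice
    mean retains the mean alone. *)
Lemma node_mean_trigpoly d (a : 'I_d -> nat) M (P : 'rV[R]_d -> R) : (0 < M)%N ->
  (forall j, (0 < a j)%N) -> (forall j, (a j %| M)%N) ->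
  trigpoly_lt a P -> node_mean a M P = torus_int P.
Proof.
move=> M0 a0 aM hP; rewrite {1}(trigpoly_lt_trig hP) node_mean_trig //.
have z0 : (0 : 'rV[int]_d) \in box_seq a by rewrite mem_box_seq; apply/forallP => j; rewrite mxE.
rewrite big_mkcond (bigD1_seq 0) ?uniq_box_seq // big_seq_cond big1 ?addr0 => [|n /andP[nr n0]].
  case: ifPn => [_|/forallPn[j]]; last by rewrite mxE dvdn0.
  transitivity (torus_int (fun x => P x * cos (2 * pi * dotZ 0 x))).
    by rewrite Re_fourier; exact: addr0.
  congr torus_int; apply/funext => x.
  by rewrite dotZ0l mulr0 cos0 mulr1.
case: forallP => // h; case/eqP: n0; apply/rowP => j; rewrite mxE; apply/eqP.
rewrite -absz_eq0; move: nr; rewrite mem_box_seq => /forallP/(_ j) nj.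
by apply/eqP/(dvdn_lt_eq0 (h j)).
Qed.

Lemma lattice_node d (a : 'I_d -> nat) M (f : 'rV[R]_d -> R) (n : 'rV[int]_d) :
  (forall j, (0 < a j)%N) -> (forall j, (a j <= M)%N) -> Zperiodic f ->
  exists s : {ffun 'I_d -> 'I_M}, f (lattice_point R a n) = f (node a s).
Proof.
move=> a0 aM pf.
have hr j : (absz (n 0%R j %% (a j)%:Z)%Z < M)%N.
  apply: leq_trans (aM j); rewrite -ltz_nat gez0_abs ?modz_ge0 ?gt_eqF ?ltz_nat //.
  by rewrite ltz_pmod // ltz_nat.
exists [ffun j => Ordinal (hr j)].
rewrite -[RHS](pf _ (\row_j (n 0%R j %/ (a j)%:Z)%Z)); congr f; apply/rowP => j.
rewrite !mxE ffunE /= natr_absz ger0_norm ?modz_ge0 ?gt_eqF ?ltz_nat //.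
have aR : (a j)%:R != 0 :> R by rewrite pnatr_eq0 -lt0n.
rewrite {1}(divz_eq (n 0 j) (a j)%:Z) intrD intrM -pmulrn.
by field.
Qed.

End TrigPoly.

(** * The extremal majorant and its optimality *)

Section Extremal.
Variables (R : realType) (d : nat) (a : 'I_d -> nat).
Hypothesis ha : forall j, (0 < a j)%N.
Variable nu : {measure set (borel R d) -> \bar R}.
Hypothesis hnu : (theta_int a nu < +oo)%E.
Let La : set (borel R d) := @Lambda R d.

Lemma theta_intE : theta_int a nu =
  (\int[nu]_(l in La) (gaphat a (l : 'rV[R]_d) 0)%:E)%E.
Proof.
apply: eq_integral => l; rewrite inE => hl; by rewrite theta_weightE.
Qed.

Lemma gaphat0_ge0 (l : 'rV[R]_d) : Lambda l -> 0 <= gaphat a l 0.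
Proof. by move=> hl; apply: le_trans (gaphat_dist 0 ha hl). Qed.

Lemma integrable_gaphat k :
  nu.-integrable La (EFin \o (fun l : borel R d => gaphat a (l : 'rV[R]_d) k)).
Proof.
have mL := @measurable_Lambda R d.
apply: (@le_integrable _ _ _ _ _ mL _ (EFin \o (fun l : borel R d => gaphat a (l : 'rV[R]_d) 0))).
- by apply/measurable_EFinP; exact: measurable_gaphat.
- move=> l hl; rewrite lee_fin (ger0_norm (gaphat0_ge0 hl)); exact: gaphat_dist.
- apply/integrableP; split; first by apply/measurable_EFinP; exact: measurable_gaphat.
  move: hnu; rewrite theta_intE; congr (_ < _)%E.
  apply: eq_integral => l; rewrite inE => hl.
  by rewrite /= ger0_norm // gaphat0_ge0.
Qed.

Definition gapint k : R := (\int[nu]_(l in La) gaphat a (l : 'rV[R]_d) k)%R.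

Lemma theta_int_gapint : theta_int a nu = (gapint 0)%:E.
Proof.
rewrite theta_intE /gapint /Rintegral fineK //.
by apply: integrable_fin_num (integrable_gaphat 0); exact: measurable_Lambda.
Qed.

Lemma gapintN k : gapint (- k) = gapint k.
Proof.
congr fine; apply: eq_integral => l _; congr (_%:E).
by rewrite /gaphat /majhat /gauhat; congr (_ * _ - _ * _);
  apply: eq_bigr => j _; rewrite mxE abszN.
Qed.

(** The inequality of [gaphat_kernel_ge0] holds for each [l]; as the sum is finite and its terms are
    integrable, it integrates term by term. *)
Lemma gapint_kernel_ge0 N (x : 'rV[R]_d) :
  0 <= \sum_(f : {ffun 'I_d -> 'I_(N + N).+1})
    (\prod_j kwt 1 N (absz (freq f 0 j))) * cos (2 * pi * dotZ (freq f) x) *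
    gapint (freq f).
Proof.
have mL := @measurable_Lambda R d.
pose K (f : {ffun 'I_d -> 'I_(N + N).+1}) : R :=
  (\prod_j kwt 1 N (absz (freq f 0 j))) * cos (2 * pi * dotZ (freq f) x).
have -> : \sum_f K f * gapint (freq f) =
   (\int[nu]_(l in La) (\sum_f K f * gaphat a (l : 'rV[R]_d) (freq f)))%R.
  have iK f : nu.-integrable La (EFin \o (fun l : borel R d => K f * gaphat a (l : 'rV[R]_d) (freq f))).
    have := integrableZl mL (K f) (integrable_gaphat (freq f)).
    by apply: eq_integrable => // l _; rewrite /= EFinM.
  have isum r : nu.-integrable La (EFin \o (fun l : borel R d => \sum_(f <- r) K f * gaphat a (l : 'rV[R]_d) (freq f))).
    elim: r => [|f r IH].
      by under eq_fun do rewrite big_nil; exact: integrable0.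
    have := integrableD mL (iK f) IH.
    by apply: eq_integrable => // l _; rewrite /= big_cons EFinD.
  elim: (index_enum _) => [|f r IH].
    by rewrite big_nil; under eq_Rintegral do rewrite big_nil; rewrite Rintegral_cst // mul0r.
  under eq_Rintegral do rewrite big_cons.
  by rewrite RintegralD // big_cons IH RintegralZl //; exact: integrable_gaphat.
apply: Rintegral_ge0 => l hl; exact: gaphat_kernel_ge0.
Qed.

Variable g : 'rV[R]_d -> R.
Hypotheses (gper : Zperiodic g) (gcont : continuous g).
Hypothesis hg : forall k : 'rV[int]_d, (exists j, (a j)%:Z <= `|k 0 j|) ->
       complex.Im (fourier g k) = 0 /\
       (complex.Re (fourier g k))%:E =
         (\int[nu]_(l in (@Lambda R d : set (borel R d)))
            (Ghat l (map_mx intr k))%:E)%E.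

Lemma fourier_outside k : k \notin box_seq a ->
  complex.Im (fourier g k) = 0 /\
  (complex.Re (fourier g k))%:E = (\int[nu]_(l in La) (gauhat (l : 'rV[R]_d) k)%:E)%E.
Proof.
rewrite mem_box_seq => /forallPn[j]; rewrite -leqNgt => hj.
have [|h1 h2] := hg (k := k); first by exists j; rewrite -abszE lez_nat.
split=> //; rewrite h2; apply: eq_integral => l _.
by rewrite GhatE.
Qed.

Lemma gapint_outside k : k \notin box_seq a -> gapint k = - complex.Re (fourier g k).
Proof.
move=> hk; have [_ h] := fourier_outside hk.
move: hk; rewrite mem_box_seq => /forallPn[j]; rewrite -leqNgt => hj.
have mL := @measurable_Lambda R d.
have E l : gaphat a l k = -1 * gauhat l k by rewrite (@gaphat_outside _ _ _ _ _ j) // mulN1r.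
have iG : nu.-integrable La (EFin \o (fun l : borel R d => gauhat (l : 'rV[R]_d) k)).
  have := integrableZl mL (-1) (integrable_gaphat k).
  by apply: eq_integrable => // l _; rewrite /= E mulN1r mulN1e EFinN oppeK.
rewrite -[complex.Re _]/(fine (complex.Re (fourier g k))%:E) h /gapint.
under eq_Rintegral do rewrite E.
by rewrite RintegralZl // mulN1r.
Qed.

Let bg : bmeas g := bmeas_periodic gper gcont.

(** This is g plus the gap, frequency by frequency: outside the box [gapint n] cancels the
    coefficient of g, so the sum stops there. Inside, the coefficients of g are unrestricted and are
    simply copied. *)
Definition extremal : 'rV[R]_d -> R :=
  trig (box_seq a) (fun n => complex.Re (fourier g n) + gapint n)
    (fun n => complex.Im (fourier g n)).

Lemma Re_fourierN (f : 'rV[R]_d -> R) n : complex.Re (fourier f (- n)) = complex.Re (fourier f n).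
Proof.
rewrite !Re_fourier; congr torus_int; apply/funext => x.
by rewrite dotZNl mulrN cosN.
Qed.

Lemma Im_fourierN (f : 'rV[R]_d -> R) n : bmeas f ->
  complex.Im (fourier f (- n)) = - complex.Im (fourier f n).
Proof.
move=> bf; rewrite !Im_fourier // opprK.
have := torus_intZ (-1) (bmeasM bf (bmeas_sin R (- n))); rewrite mulN1r => <-.
by congr torus_int; apply/funext => x; rewrite dotZNl mulrN sinN; ring.
Qed.

Lemma extremal_trigpoly_lt : trigpoly_lt a extremal.
Proof.
apply: trig_trigpoly_lt => m; first by rewrite Re_fourierN gapintN.
exact: Im_fourierN.
Qed.

Lemma extremal_periodic : Zperiodic extremal.
Proof. exact: trig_periodic. Qed.

Lemma extremal_continuous : continuous extremal.
Proof. exact: trig_continuous. Qed.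

Let gap (x : 'rV[R]_d) := extremal x - g x.

Lemma gap_periodic : Zperiodic gap.
Proof. by move=> x n; rewrite /gap gper extremal_periodic. Qed.

Lemma gap_continuous : continuous gap.
Proof.
by move=> x; apply: (@continuousB _ _ _ extremal g); [exact: extremal_continuous|exact: gcont].
Qed.

Lemma fourierB (f h : 'rV[R]_d -> R) n : bmeas f -> bmeas h ->
  fourier (fun x => f x - h x) n = fourier f n - fourier h n.
Proof.
move=> bf bh; have bc : bmeas (fun x : 'rV[R]_d => cos (2 * pi * dotZ n x)).
  have := bmeas_cos (0 : R) n.
  by congr bmeas; apply/funext => y; rewrite add0r.
have bs := bmeas_sin R n.
apply: eqcP.
  have -> : complex.Re (fourier f n - fourier h n) =
    complex.Re (fourier f n) - complex.Re (fourier h n) by case: (fourier f n) => u v; case: (fourier h n).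
  rewrite !Re_fourier -torus_intB; [|exact: bmeasM|exact: bmeasM].
  by congr torus_int; apply/funext => x; rewrite mulrBl.
have -> : complex.Im (fourier f n - fourier h n) =
    complex.Im (fourier f n) - complex.Im (fourier h n) by case: (fourier f n) => u v; case: (fourier h n).
rewrite !Im_fourier //; last exact: bmeasB.
have -> : torus_int (fun x => (f x - h x) * sin (2 * pi * dotZ n x)) =
    torus_int (fun x => f x * sin (2 * pi * dotZ n x)) -
    torus_int (fun x => h x * sin (2 * pi * dotZ n x)).
  rewrite -torus_intB; [|exact: bmeasM|exact: bmeasM].
  by congr torus_int; apply/funext => x; rewrite mulrBl.
by rewrite opprB opprK addrC.
Qed.

Lemma fourier_gap n : fourier gap n = (gapint n)%:C.
Proof.
rewrite fourierB //; last exact: bmeas_trig.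
rewrite fourier_trig ?uniq_box_seq //; last 3 first.
- exact: box_seqN.
- by move=> m; rewrite Re_fourierN gapintN.
- by move=> m; exact: Im_fourierN.
have := @fourier_outside n; have := @gapint_outside n; move: (fourier g n) => z.
case: (boolP (n \in box_seq a)) => nb.
  by move=> _ _; case: z => u v; apply: eqcP; rewrite /=; ring.
move=> /(_ isT) -> /(_ isT)[h _]; move: h; case: z => u v /= ->.
by apply: eqcP; rewrite /=; ring.
Qed.

Lemma gap_ge0 x : 0 <= gap x.
Proof.
have cv := @korovkin_kwt R d gap x gap_periodic gap_continuous.
apply: (cvgr_to_ge cv).
near=> N; rewrite /sigma.
under eq_bigr do rewrite fourier_gap mul0r subr0 (mulrC (gapint _)) mulrA.
exact: gapint_kernel_ge0.
Unshelve. all: by end_near. Qed.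

Let M := (\prod_j a j)%N.

Let M0 : (0 < M)%N.
Proof. by rewrite prodn_gt0. Qed.

Let aM j : (a j %| M)%N.
Proof. by rewrite /M (bigD1 j) //= dvdn_mulr. Qed.

Lemma node_meanB (f h : 'rV[R]_d -> R) :
  node_mean a M (fun x => f x - h x) = node_mean a M f - node_mean a M h.
Proof. by rewrite /node_mean -mulrBr -sumrB. Qed.

Lemma le_node_mean (f h : 'rV[R]_d -> R) : (forall x, f x <= h x) ->
  node_mean a M f <= node_mean a M h.
Proof.
by move=> fh; rewrite ler_wpM2l ?invr_ge0 ?ler0n // ler_sum.
Qed.

Lemma node_mean_sigma N : node_mean a M (sigma N (kwt 1 N) g) =
  complex.Re (fourier g 0) +
  \sum_(f : {ffun 'I_d -> 'I_(N + N).+1} | aliased a (freq f) && (freq f != 0))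
    (\prod_j kwt 1 N (absz (freq f 0 j))) * complex.Re (fourier g (freq f)).
Proof.
pose w n : R := \prod_j kwt 1 N (absz ((n : 'rV[int]_d) 0 j)).
have -> : sigma N (kwt 1 N) g = trig [seq freq f | f : {ffun 'I_d -> 'I_(N + N).+1}]
    (fun n => w n * complex.Re (fourier g n)) (fun n => w n * complex.Im (fourier g n)).
  apply/funext => x; rewrite /trig big_map big_enum; apply: eq_bigr => f _.
  by rewrite mulrBr !mulrA.
rewrite node_mean_trig // big_map big_enum_cond /=.
have [f0 f0E] : exists f, freq (d := d) (N := N) f = 0.
  by apply: freqP => j; rewrite mxE.
rewrite (bigD1 f0) /=; last by rewrite f0E; apply/forallP => j; rewrite mxE dvdn0.
congr (_ + _).
  by rewrite f0E /w big1 ?mul1r // => j _; rewrite mxE /kwt big_ord0.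
by apply: eq_bigl => f; rewrite -f0E (inj_eq (@freq_inj d N)).
Qed.

(** A nonzero aliased frequency lies outside the box, exactly where the coefficients of g are
    prescribed as [nu]-integrals of Gaussian ones. *)
Lemma integral_psi N : (\int[nu]_(l in La) (psi a N (l : 'rV[R]_d))%:E)%E =
  (node_mean a M (sigma N (kwt 1 N) g) - complex.Re (fourier g 0))%:E.
Proof.
have mL := @measurable_Lambda R d.
rewrite node_mean_sigma addrC addKr.
have out (f : {ffun 'I_d -> 'I_(N + N).+1}) : aliased a (freq f) && (freq f != 0) ->
    freq f \notin box_seq a.
  move=> /andP[/forallP h f0]; apply: contra f0 => hb; apply/eqP/rowP => j.
  rewrite [RHS]mxE; apply/eqP; rewrite -absz_eq0; move: hb; rewrite mem_box_seq => /forallP/(_ j).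
  by move=> hj; apply/eqP/(dvdn_lt_eq0 (h j)).
pose s := [seq f <- index_enum {ffun 'I_d -> 'I_(N + N).+1} | aliased a (freq f) && (freq f != 0)].
pose K (f : {ffun 'I_d -> 'I_(N + N).+1}) : R := \prod_j kwt 1 N (absz (freq f 0 j)).
have K0 f : 0 <= K f by apply: prodr_ge0 => j _; exact: kwt_ge0.
transitivity (\int[nu]_(l in La) (\sum_(f <- s) (K f)%:E * (gauhat (l : 'rV[R]_d) (freq f))%:E))%E.
  apply: eq_integral => l _; rewrite big_filter /psi -sumEFin.
  by apply: eq_bigr => f _; rewrite EFinM.
rewrite ge0_integral_sum //; last 2 first.
- by move=> f; apply: measurable_funeM; apply/measurable_EFinP; exact: measurable_gauhat.
- by move=> f l hl; rewrite -EFinM lee_fin mulr_ge0 // gauhat_ge0.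
rewrite big_filter -sumEFin; apply: eq_bigr => f hf.
rewrite ge0_integralZl_EFin //; last 2 first.
- by move=> l hl; rewrite lee_fin gauhat_ge0.
- by apply/measurable_EFinP; exact: measurable_gauhat.
by rewrite EFinM; have [_ ->] := fourier_outside (out f hf).
Qed.

Lemma theta_int_le : (theta_int a nu <= (node_mean a M g - complex.Re (fourier g 0))%:E)%E.
Proof.
have mL := @measurable_Lambda R d.
have cv : node_mean a M (sigma N (kwt 1 N) g) - complex.Re (fourier g 0) @[N --> \oo] -->
   node_mean a M g - complex.Re (fourier g 0).
  apply: cvgB; last exact: cvg_cst.
  apply: cvgM; first exact: cvg_cst.
  apply: cvg_big => [x|s _]; first exact: add_continuous.
  exact: korovkin_kwt.
have mpsi N : measurable_fun La (fun l : borel R d => (psi a N (l : 'rV[R]_d))%:E).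
  apply/measurable_EFinP.
  apply: (@eq_measurable_fun _ _ _ _ _ (fun l : borel R d =>
      \sum_(f <- [seq f <- index_enum {ffun 'I_d -> 'I_(N + N).+1} | aliased a (freq f) && (freq f != 0)])
     (\prod_j kwt 1 N (absz (freq f 0 j))) * gauhat (l : 'rV[R]_d) (freq f))).
    by move=> l _; rewrite big_filter.
  apply: measurable_sum => f; apply: measurable_funM; first exact: measurable_cst.
  exact: measurable_gauhat.
have := @fatou _ _ _ nu La mL (fun N (l : borel R d) => (psi a N (l : 'rV[R]_d))%:E) mpsi.
have psi0 N (l : borel R d) : La l -> (0 <= (psi a N (l : 'rV[R]_d))%:E)%E.
  by move=> hl; rewrite lee_fin psi_ge0.
move=> /(_ psi0).
rewrite (funext integral_psi).
have /cvg_limn_einf_sup[-> _] : ((node_mean a M (sigma N (kwt 1 N) g) - complex.Re (fourier g 0))%:E @[N --> \oo] -->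
   (node_mean a M g - complex.Re (fourier g 0))%:E)%E.
  by apply: cvg_EFin; [exact: nearW|exact: cv].
apply: le_trans; rewrite theta_intE le_eqVlt; apply/orP; left; apply/eqP.
apply: eq_integral => l; rewrite inE => hl; apply/esym.
have /cvg_limn_einf_sup[-> _] // : ((psi a N (l : 'rV[R]_d))%:E @[N --> \oo] -->
   (gaphat a (l : 'rV[R]_d) 0)%:E)%E.
by apply: cvg_EFin; [exact: nearW|exact: cvg_psi].
Qed.

Lemma torus_int_fourier0 (f : 'rV[R]_d -> R) : complex.Re (fourier f 0) = torus_int f.
Proof.
rewrite Re_fourier; congr torus_int; apply/funext => x.
by rewrite dotZ0l mulr0 cos0 mulr1.
Qed.

Lemma theta_int_le_majorant (P : 'rV[R]_d -> R) : trigpoly_lt a P ->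
  (forall x, g x <= P x) ->
  (theta_int a nu <= (torus_int (fun x => P x - g x))%:E)%E.
Proof.
move=> hP gP; apply: le_trans theta_int_le _; rewrite lee_fin.
rewrite torus_intB //; last by rewrite (trigpoly_lt_trig hP); exact: bmeas_trig.
rewrite torus_int_fourier0 lerD2r -(node_mean_trigpoly M0 ha aM hP).
exact: le_node_mean.
Qed.

Lemma torus_int_gap : (torus_int gap)%:E = theta_int a nu.
Proof. by rewrite -torus_int_fourier0 fourier_gap /= theta_int_gapint. Qed.

Lemma gap_node (s : {ffun 'I_d -> 'I_M}) : gap (node R a s) = 0.
Proof.
have bm : bmeas extremal by exact: bmeas_trig.
have le0 : node_mean a M gap <= 0.
  (* The lattice mean of [extremal] is its integral, which by [theta_int_le] and [torus_int_gap] is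
     at most the lattice mean of g. *)
  rewrite node_meanB (node_mean_trigpoly M0 ha aM extremal_trigpoly_lt).
  have := theta_int_le; rewrite -torus_int_gap lee_fin torus_intB // torus_int_fourier0.
  lra.
have Mp : 0 < (M ^ d)%:R^-1 :> R by rewrite invr_gt0 ltr0n expn_gt0 M0.
have S0 : \sum_(s : {ffun 'I_d -> 'I_M}) gap (node R a s) = 0.
  apply/eqP; rewrite eq_le sumr_ge0 ?andbT => [|s' _]; last exact: gap_ge0.
  by rewrite -(pmulr_rle0 _ Mp).
have /eqP := S0; rewrite psumr_eq0 => [/allP/(_ s)|s' _]; last exact: gap_ge0.
by rewrite mem_index_enum => /(_ isT) /eqP.
Qed.

End Extremal.

Unset Implicit Arguments.

Theorem theorem16 (R : realType) (d : nat) (hd : (0 < d)%N)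
    (a : 'I_d -> nat) (ha : forall j, (1 <= a j)%N)
    (nu : {measure set (borel R d) -> \bar R})
    (hnu : (theta_int a nu < +oo)%E)
    (g : 'rV[R]_d -> R) (gper : Zperiodic g) (gcont : continuous g)
    (hg : forall k : 'rV[int]_d, (exists j, (a j)%:Z <= `|k 0 j|) ->
       complex.Im (fourier g k) = 0 /\
       (complex.Re (fourier g k))%:E =
         (\int[nu]_(l in (@Lambda R d : set (borel R d)))
            (Ghat l (map_mx intr k))%:E)%E) :
  (forall P : 'rV[R]_d -> R, trigpoly_lt a P -> (forall x, g x <= P x) ->
     (theta_int a nu <= (torus_int (fun x => P x - g x))%:E)%E)
  /\
  (exists m : 'rV[R]_d -> R,
     [/\ trigpoly_lt a m,
         forall x, g x <= m x,
         forall n : 'rV[int]_d,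
           m (lattice_point R a n) = g (lattice_point R a n) &
         (torus_int (fun x => m x - g x))%:E = theta_int a nu]).
Proof.
split=> [P hP gP|]; first exact: theta_int_le_majorant hP gP.
exists (extremal a nu g); split.
- exact: extremal_trigpoly_lt.
- by move=> x; rewrite -subr_ge0; exact: gap_ge0.
- move=> n; apply/eqP; rewrite -subr_eq0; apply/eqP.
  have aM j : (a j <= \prod_j a j)%N.
    by rewrite dvdn_leq ?prodn_gt0 // (bigD1 j) //= dvdn_mulr.
  have [s sE] := lattice_node n ha aM (gap_periodic a nu gper).
  by rewrite sE; exact: gap_node.
- exact: torus_int_gap.
Qed.
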